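(* There exists a deterministic polynomial-time oracle algorithm which, given as an oracle an indecomposable POS-hyperbolic polynomial $p(x_1,\dots,x_n)\in\mathrm{Hom}_+(n,n)$ with nonnegative integer coefficients, computes a number $F(p)$ satisfying $$\frac{\partial^n}{\partial x_1\cdots\partial x_n}p(0,\dots,0)\le F(p)\le 2\Big(\prod_{1\le i\le n}g\big(\min(S_p(\{i\}),n+1-i)\big)\Big)^{-1}\frac{\partial^n}{\partial x_1\cdots\partial x_n}p(0,\dots,0)\le 2\,\frac{n^n}{n!}\,\frac{\partial^n}{\partial x_1\cdots\partial x_n}p(0,\dots,0).$$
   Context: $\mathrm{Hom}_+(n,n)$: homogeneous polynomials of degree $n$ in $n$ real variables with nonnegative coefficients. With $e=(1,\dots,1)$, $p$ is POS-hyperbolic if $p(e)>0$, for every real $X$ all roots of $t\mapsto p(X-te)$ are real, and for $X$ with nonnegative coordinates they are nonnegative. $p$ is indecomposable if $\inf\{p(x):x_i>0,\prod_ix_i=1\}$ is attained at a unique point. $S_p(\{i\})$ is the largest exponent of $x_i$ among monomials of $p$ with nonzero coefficient. $g(k)=((k-1)/k)^{k-1}$ for $k\ge1$ ($0^0=1$), $g(0)=1$. The mixed derivative $\frac{\partial^n}{\partial x_1\cdots\partial x_n}p(0,\dots,0)$ is the coefficient of $x_1\cdots x_n$. ''Given as an oracle'' means $p$ can only be evaluated at rational vectors. A deterministic polynomial-time oracle algorithm is one that evaluates $p$ at a number of rational vectors polynomial in $n$ and $\log p(1,\dots,1)$, these vectors having bit size polynomial in $n$ and $\log p(1,\dots,1)$,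 and performs a number of additional arithmetic operations polynomial in $n$ and $\log p(1,\dots,1)$. *)

(* Defs.v *)
From HB Require Import structures.
From mathcomp Require Import all_boot all_order all_algebra.
From mathcomp Require Import complex mpoly.
From mathcomp Require Import classical_sets reals exp.

Set Implicit Arguments.
Unset Strict Implicit.
Unset Printing Implicit Defensive.

Import Order.TTheory GRing.Theory Num.Theory.
Local Open Scope ring_scope.

(** * Polynomials *)

Definition hom_plus (R : numDomainType) (d n : nat) (p : {mpoly R[n]}) : Prop :=
  p \is d.-homog /\ forall m : 'X_{1..n}, 0 <= p@_m.

(* All roots of t |-> p (X - t e) are taken in R[i], so that "all roots are
   real" is meaningful; [0 <= z] in R[i] means that z is real and nonnegative. *)
Definition pos_hyperbolic (R : realType) (n : nat) (p : {mpoly R[n]}) : Prop :=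
  let is_root (X : 'I_n -> R) (z : R[i]) :=
    (map_mpoly (real_complex R) p).@[fun i => real_complex R (X i) - z] = 0 in
  [/\ 0 < p.@[fun=> 1],
      forall (X : 'I_n -> R) (z : R[i]), is_root X z -> z \is Num.real
    & forall (X : 'I_n -> R) (z : R[i]),
        (forall i, 0 <= X i) -> is_root X z -> 0 <= z].

Definition unit_prod (R : realType) (n : nat) : set ('rV[R]_n) :=
  [set x | (forall i, 0 < x 0 i) /\ \prod_i x 0 i = 1]%classic.
Arguments unit_prod : clear implicits.

Definition capacity (R : realType) (n : nat) (p : {mpoly R[n]}) : R :=
  inf [set p.@[x 0] | x in unit_prod R n]%classic.

Definition indecomposable (R : realType) (n : nat) (p : {mpoly R[n]}) : Prop :=
  exists! x : 'rV[R]_n, unit_prod R n x /\ p.@[x 0] = capacity p.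

Definition max_degree (R : nzRingType) (n : nat) (p : {mpoly R[n]}) (i : 'I_n)
    : nat :=
  \max_(m <- msupp p) m i.

(* [0 / 0 = 0] and [x ^+ 0 = 1] give [gfun 0 = gfun 1 = 1]. *)
Definition gfun (k : nat) : rat := (k.-1%:R / k%:R) ^+ k.-1.

Definition mixed_derivative (R : nzRingType) (n : nat) (p : {mpoly R[n]}) : R :=
  (p^`M[[multinom 1%N | i < n]]).@[fun=> 0].

(** * Oracle programs *)

(* Programs are written in a finite WHILE language.  The memory consists of
   index registers holding natural numbers, used for counting and addressing,
   and of cells holding rational numbers, addressed by index expressions.  The
   four field operations and comparison are the only operations on rationals
   (no rounding).  A single program serves all numbers n of variables. *)

Inductive iexp : Type :=
| IConst of nat
| IReg of nat
| IAdd of iexp & iexp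
| ISub of iexp & iexp.

Inductive qexp : Type :=
| QConst of rat
| QCell of iexp
| QAdd of qexp & qexp
| QSub of qexp & qexp
| QMul of qexp & qexp
| QDiv of qexp & qexp.

Inductive test : Type :=
| ILt of iexp & iexp
| QLt of qexp & qexp
| TNot of test.

Inductive cmd : Type :=
| Skip
| SetReg of nat & iexp
| SetCell of iexp & qexp
| Query of iexp & iexp
| Seq of cmd & cmd
| If of test & cmd & cmd
| While of test & cmd.

Record state : Type := State { regs : nat -> nat; cells : nat -> rat }.

Definition upd (T : Type) (f : nat -> T) (a : nat) (v : T) : nat -> T :=
  fun b => if b == a then v else f b.

Fixpoint ieval (s : state) (e : iexp) : nat :=
  match e with
  | IConst k => k
  | IReg a => regs s a
  | IAdd e1 e2 => (ieval s e1 + ieval s e2)%N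
  | ISub e1 e2 => (ieval s e1 - ieval s e2)%N
  end.

(* Division by zero yields 0. *)
Fixpoint qeval (s : state) (e : qexp) : rat :=
  match e with
  | QConst c => c
  | QCell i => cells s (ieval s i)
  | QAdd e1 e2 => qeval s e1 + qeval s e2
  | QSub e1 e2 => qeval s e1 - qeval s e2
  | QMul e1 e2 => qeval s e1 * qeval s e2
  | QDiv e1 e2 => qeval s e1 / qeval s e2
  end.

Fixpoint teval (s : state) (b : test) : bool :=
  match b with
  | ILt e1 e2 => (ieval s e1 < ieval s e2)%N
  | QLt e1 e2 => qeval s e1 < qeval s e2
  | TNot b => ~~ teval s b
  end.

Fixpoint isize (e : iexp) : nat :=
  match e with
  | IConst _ | IReg _ => 1%N
  | IAdd e1 e2 | ISub e1 e2 => (isize e1 + isize e2).+1%N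
  end.

Fixpoint qsize (e : qexp) : nat :=
  match e with
  | QConst _ => 1%N
  | QCell i => (isize i).+1
  | QAdd e1 e2 | QSub e1 e2 | QMul e1 e2 | QDiv e1 e2 =>
      (qsize e1 + qsize e2).+1%N
  end.

Fixpoint bsize (b : test) : nat :=
  match b with
  | ILt e1 e2 => (isize e1 + isize e2).+1%N
  | QLt e1 e2 => (qsize e1 + qsize e2).+1%N
  | TNot b => (bsize b).+1
  end.

(* [exec f c s t qs s']: with oracle f, the command c started in s halts in s'
   after t operations, having evaluated f successively at the vectors qs.
   Every arithmetic operation, comparison, memory access and assignment is
   counted in t, on index registers as well as on rational cells. *)
Inductive exec (n : nat) (f : 'rV[rat]_n -> rat) :
  cmd -> state -> nat -> seq 'rV[rat]_n -> state -> Prop :=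
| ExecSkip s : exec f Skip s 1%N [::] s
| ExecSetReg a e s :
    exec f (SetReg a e) s (isize e).+1 [::]
      (State (upd (regs s) a (ieval s e)) (cells s))
| ExecSetCell i e s :
    exec f (SetCell i e) s (isize i + qsize e).+1%N [::]
      (State (regs s) (upd (cells s) (ieval s i) (qeval s e)))
| ExecQuery i j s (x := \row_(k < n) cells s (ieval s i + k)%N) :
    exec f (Query i j) s (isize i + isize j).+1%N [:: x]
      (State (regs s) (upd (cells s) (ieval s j) (f x)))
| ExecSeq c1 c2 s s1 s2 t1 t2 qs1 qs2 :
    exec f c1 s t1 qs1 s1 -> exec f c2 s1 t2 qs2 s2 ->
    exec f (Seq c1 c2) s (t1 + t2)%N (qs1 ++ qs2) s2
| ExecIf b c1 c2 s s' t qs :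
    exec f (if teval s b then c1 else c2) s t qs s' ->
    exec f (If b c1 c2) s (bsize b + t)%N qs s'
| ExecWhileStop b c s :
    ~~ teval s b -> exec f (While b c) s (bsize b) [::] s
| ExecWhileStep b c s s1 s2 t1 t2 qs1 qs2 :
    teval s b -> exec f c s t1 qs1 s1 -> exec f (While b c) s1 t2 qs2 s2 ->
    exec f (While b c) s (bsize b + t1 + t2)%N (qs1 ++ qs2) s2.

Lemma exec_deterministic n (f : 'rV[rat]_n -> rat) c s t1 t2 qs1 qs2 s1 s2 :
  exec f c s t1 qs1 s1 -> exec f c s t2 qs2 s2 ->
  [/\ t1 = t2, qs1 = qs2 & s1 = s2].
Proof.
move=> e1; elim: e1 t2 qs2 s2 => {c s t1 qs1 s1}.
- by move=> s t2 qs2 s2 e2; inversion e2.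
- by move=> a e s t2 qs2 s2 e2; inversion e2.
- by move=> i e s t2 qs2 s2 e2; inversion e2.
- by move=> i j s x t2 qs2 s2 e2; inversion e2.
- move=> c1 c2 s s1 s' t1 t' qs1 qs' _ IH1 _ IH2 t2 qs2 s2 e2.
  inversion e2 as [| | | |d1 d2 r r1 r2 u1 u2 us1 us2 f1 f2| | |]; subst.
  case: (IH1 _ _ _ f1) => ? ? ?; subst.
  by case: (IH2 _ _ _ f2) => ? ? ?; subst.
- move=> b c1 c2 s s' t qs _ IH t2 qs2 s2 e2.
  inversion e2 as [| | | | |d d1 d2 r r' u us f1| |]; subst.
  by case: (IH _ _ _ f1) => ? ? ?; subst.
- move=> b c s nb t2 qs2 s2 e2.
  inversion e2 as [| | | | | | |d d1 r r1 r2 u1 u2 us1 us2 h f1 f2]; subst=> //.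
  by rewrite h in nb.
- move=> b c s s1 s' t1 t' qs1 qs' bs _ IH1 _ IH2 t2 qs2 s2 e2.
  inversion e2 as [| | | | | |d d1 r h|d d1 r r1 r2 u1 u2 us1 us2 h f1 f2];
    subst; first by rewrite bs in h.
  case: (IH1 _ _ _ f1) => ? ? ?; subst.
  by case: (IH2 _ _ _ f2) => ? ? ?; subst.
Qed.

(* The input is the number n of variables, in register 0. *)
Definition init_state (n : nat) : state := State (upd (fun=> 0%N) 0%N n) (fun=> 0).

Definition output (s : state) : rat := cells s 0%N.

(* [up_log 2 k.+1] is the length of the binary expansion of k. *)
Definition rat_bits (q : rat) : nat :=
  (1 + up_log 2 `|numq q|.+1 + up_log 2 `|denq q|.+1)%N.

Definition vec_bits (n : nat) (x : 'rV[rat]_n) : nat :=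
  (\sum_(i < n) rat_bits (x ord0 i))%N.

Definition eval_oracle (n : nat) (p : {mpoly int[n]}) (x : 'rV[rat]_n) : rat :=
  (map_mpoly intr p).@[x 0].

(* [computes A Q B T p F]: with p given as an oracle, A halts with output F,
   and the number of queries, their bit sizes and the number of operations are
   bounded by the bivariate polynomials Q, B and T at (n, log p(1, ..., 1)). *)
Definition computes (R : realType) (A : cmd) (Q B T : {poly {poly R}})
    (n : nat) (p : {mpoly int[n]}) (F : rat) : Prop :=
  let bound (P : {poly {poly R}}) : R :=
    P.[n%:R, ln (map_mpoly intr p).@[fun=> 1]] in
  exists (t : nat) (qs : seq 'rV[rat]_n) (s : state),
    [/\ exec (eval_oracle p) A (init_state n) t qs s, output s = F
      & [/\ (size qs)%:R <= bound Q,
            forall x, x \in qs -> (vec_bits x)%:R <= bound B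
          & t%:R <= bound T]].

(* Main.v *)
(* Write cap(p) for the infimum of p(x) / (x_1 ... x_n) over x > 0.

   Capacity versus coefficient.  Hyperbolicity along e and nonnegativity give
   |p(z)| >= p(Im z) for Im z >= 0, by Garding's homotopy.  This inequality is
   inherited by the partial derivatives and makes t |-> p(x + t e_k) real-rooted
   for x >= 0, whence AM-GM yields Gurvits' one-variable bound
   g(deg R) * inf R(t) / t <= R'(0).  Eliminating the variables one by one gives
   (prod_i g) cap(p) <= D <= cap(p), where D is the mixed derivative.

   Approximating the capacity.  Start from x = (1, ..., 1) and replace some x_i
   by q x_i, where q = 1 + s with s = 1/(8 n^3 K) and 2^K >= p(1, ..., 1), as
   long as this divides p(x) / (x_1 ... x_n) by at least 1 / (1 - s^2).  The
   points visited lie on a geometric grid, hence have polynomial bit size, and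
   since D >= 1 there are at most K / s^2 successful steps.  When the search is
   stuck, every logarithmic partial derivative x_i d_i p(x) / p(x) is at least
   1 - (n^2 + 2) s.  As log p(exp u) is convex, the value reached then exceeds
   cap(p) by a factor at most 2, provided that the minimizer and x are close in
   the logarithmic scale.  They are, because p(x) / (x_1 ... x_n) >= x_i / x_j:
   the integer coefficient of x_1 ... x_n x_i / x_j is nonzero.  Indeed the
   uniqueness of the minimizer makes p(x) / (x_1 ... x_n) tend to infinity with
   x_i / x_j, and eliminating all the variables except x_i and x_j turns this
   into a statement on a quadratic form. *)

Require Import Defs.
From HB Require Import structures.
From mathcomp Require Import all_boot all_order all_algebra.
From mathcomp Require Import complex mpoly.
From mathcomp Require Import classical_sets reals exp.
From mathcomp Require Import boolp topology normedtype sequences derive.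
From mathcomp Require Import ring lra zify.

Set Implicit Arguments.
Unset Strict Implicit.
Unset Printing Implicit Defensive.

Import Order.TTheory GRing.Theory Num.Theory.
Import numFieldNormedType.Exports.
Local Open Scope ring_scope.

(** * Polynomials along a line *)

Lemma rmorph_mmap n (R S T : comNzRingType) (f : {rmorphism R -> S})
    (g : {rmorphism S -> T}) (h : 'I_n -> S) (p : {mpoly R[n]}) :
  g (mmap f h p) = mmap (g \o f) (g \o h) p.
Proof.
rewrite /mmap rmorph_sum; apply: eq_bigr => m _.
rewrite rmorphM rmorph_prod; congr (_ * _).
by apply: eq_bigr => i _; rewrite rmorphXn.
Qed.

Lemma mmap_eq n (R S : comNzRingType) (f g : R -> S)
    (h k : 'I_n -> S) (p : {mpoly R[n]}) :
  f =1 g -> h =1 k -> mmap f h p = mmap g k p.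
Proof.
move=> fg hk; rewrite /mmap; apply: eq_bigr => m _; rewrite fg.
by congr (_ * _); apply: mmap1_eq.
Qed.

Lemma meval_map_mpoly n (R S : comNzRingType) (f : {rmorphism R -> S})
    (h : 'I_n -> S) (p : {mpoly R[n]}) :
  (map_mpoly f p).@[h] = mmap f h p.
Proof.
rewrite /map_mpoly rmorph_mmap; apply: mmap_eq => [x|i] /=; first exact: mevalC.
exact: mevalXU.
Qed.

Section Line.
Context (n : nat) (R S : comNzRingType) (f : {rmorphism R -> S}).
Implicit Types (p : {mpoly R[n]}) (z v : 'I_n -> S).

(** The restriction [s |-> p(z + s v)] to a line. The morphism [f] lets one construction serve over
    R, over R[i] and over polynomial rings. *)
Definition mline p z v : {poly S} :=
  mmap (polyC \o f) (fun i => (z i)%:P + v i *: 'X) p.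

Lemma horner_mline p z v s :
  (mline p z v).[s] = mmap f (fun i => z i + s * v i) p.
Proof.
rewrite -[LHS]/(horner_eval s _) rmorph_mmap; apply: mmap_eq => [x|i] /=.
  by rewrite /horner_eval hornerC.
by rewrite /horner_eval !hornerE mulrC.
Qed.

Lemma mline0 p z v : (mline p z v)`_0 = mmap f z p.
Proof.
rewrite -horner_coef0 horner_mline; apply: mmap_eq => // i.
by rewrite mul0r addr0.
Qed.

Lemma size_affine (a b : S) : (size (a%:P + b *: 'X)%R <= 2)%N.
Proof.
rewrite (leq_trans (size_polyD _ _)) // geq_max size_polyC.
rewrite (leq_trans (size_scale_leq _ _)) ?size_polyX //.
by case: (a != 0).
Qed.

Lemma coef_affine1 (a b : S) : (a%:P + b *: 'X)`_1 = b.
Proof. by rewrite coefD coefC coefZ coefX /= mulr1 add0r. Qed.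

Lemma size_expD1 (q : {poly S}) k :
  (size q <= 2)%N -> (size (q ^+ k)%R <= k.+1)%N /\ (q ^+ k)`_k = q`_1 ^+ k.
Proof.
move=> sq; elim: k => [|k [IH1 IH2]]; first by rewrite !expr0 size_poly1 coefC.
split.
  rewrite exprS (leq_trans (size_polyMleq _ _)) //; lia.
rewrite !exprS coefM (bigD1 (inord 1)) //= inordK // subn1 /= IH2 big1 ?addr0 // => i ni.
have [i0|i1] := leqP i 1%N.
  have -> : (i : nat) = 0%N.
    apply/eqP; move: ni; rewrite -val_eqE /= inordK //; lia.
  by rewrite (@nth_default _ _ (q ^+ k)) ?mulr0 //; lia.
by rewrite (nth_default _ (leq_trans sq i1)) mul0r.
Qed.

(** In the Cauchy product at the sum of the degree bounds, every pair but one has an index beyond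
    one of the two bounds. *)
Lemma top_prod (I : Type) (r : seq I) (P : I -> {poly S}) (d : I -> nat) :
    (forall i, size (P i) <= (d i).+1)%N ->
  (size (\prod_(i <- r) P i)%R <= (\sum_(i <- r) d i).+1)%N /\
  (\prod_(i <- r) P i)`_(\sum_(i <- r) d i)%N = \prod_(i <- r) (P i)`_(d i).
Proof.
move=> sP; elim: r => [|i r [IH1 IH2]].
  by rewrite !big_nil size_poly1 coefC.
rewrite !big_cons; split.
  rewrite (leq_trans (size_polyMleq _ _)) //; have := sP i; lia.
set q := \prod_(j <- r) P j in IH1 IH2 *; set e := (\sum_(j <- r) d j)%N in IH1 IH2 *.
have lt_d : (d i < (d i + e).+1)%N by lia.
rewrite coefM (bigD1 (Ordinal lt_d)) //= addKn IH2 [X in _ + X]big1 ?addr0 // => j nj.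
have [lt_j|gt_j|eq_j] := ltngtP j (d i).
- by rewrite (@nth_default _ _ q) ?mulr0 //; have := ltn_ord j; lia.
- by rewrite nth_default ?mul0r //; apply: leq_trans (sP i) _.
- by case/eqP: nj; apply: val_inj.
Qed.

Lemma mline_mon z v (m : 'X_{1..n}) :
  let q := mmap1 (fun i => (z i)%:P + v i *: 'X) m in
  (size q <= (mdeg m).+1)%N /\ q`_(mdeg m) = mmap1 v m.
Proof.
have E i := size_expD1 (m i) (size_affine (z i) (v i)).
have [H1 H2] := top_prod (index_enum 'I_n) (fun i => proj1 (E i)).
rewrite /= mdegE; split=> //.
rewrite [LHS]H2; apply: eq_bigr => i _.
by rewrite (proj2 (E i)) coef_affine1.
Qed.

Lemma size_mline d p z v : p \is d.-homog -> (size (mline p z v) <= d.+1)%N.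
Proof.
move=> /dhomogP hp; rewrite /mline /mmap.
apply: (leq_trans (size_sum _ _ _)); apply/bigmax_leqP_seq => m mp _ /=.
rewrite mul_polyC (leq_trans (size_scale_leq _ _)) // -(hp _ mp).
exact: (proj1 (mline_mon z v m)).
Qed.

Lemma coef_mline d p z v : p \is d.-homog -> (mline p z v)`_d = mmap f v p.
Proof.
move=> /dhomogP hp; rewrite /mline /mmap coef_sum.
apply: eq_big_seq => m mp /=; rewrite mul_polyC coefZ; congr (_ * _).
by rewrite -(hp _ mp); exact: (proj2 (mline_mon z v m)).
Qed.

(** The chain rule at 0. Both sides obey the Leibniz rule, so it passes from 1 and the variables to
    monomials, and by linearity to p. *)
Lemma coef1_mline p z v :
  (mline p z v)`_1 = \sum_i v i * mmap f z p^`M(i).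
Proof.
have coef1M (a b : {poly S}) : (a * b)`_1 = a`_1 * b`_0 + a`_0 * b`_1.
  by rewrite coefM big_ord_recl big_ord1 /= addrC.
pose D q := (mline q z v)`_1 = \sum_i v i * mmap f z q^`M(i).
have DM a b : D a -> D b -> D (a * b).
  rewrite /D /mline rmorphM /= coef1M -!/(mline _ z v) => -> ->.
  rewrite !mline0 mulr_suml mulr_sumr -big_split; apply: eq_bigr => i _ /=.
  rewrite mderivM rmorphD !rmorphM /=; ring.
have DX i : D 'X_i.
  rewrite /D /mline mmapX mmap1U coef_affine1 (bigD1 i) //=.
  rewrite big1 => [|j nj].
    rewrite mderivX mnmE eqxx scale1r.
    rewrite (_ : (_ - _)%MM = 0%MM) ?mpolyX0 ?rmorph1 ?mulr1 ?addr0 //.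
    by apply/mnmP => k; rewrite mnmBE subnn mnm0E.
  by rewrite mderivX mnmE eq_sym (negPf nj) scale0r rmorph0 mulr0.
have D1 : D 1.
  rewrite /D /mline rmorph1 coefC /= big1 // => i _.
  by rewrite mderivC rmorph0 mulr0.
have DXm m : D 'X_[m].
  rewrite mpolyXE_id; elim/big_ind: _ => // i _.
  by elim: (m i) => [|k IH]; rewrite ?expr0 // exprS; apply: DM.
elim/mpolyind: p => [|c m p _ _ IH].
  rewrite /mline rmorph0 coef0 big1 // => i _.
  by rewrite mderiv0 rmorph0 mulr0.
rewrite /mline rmorphD /= mmapZ coefD mul_polyC coefZ -!/(mline _ z v) DXm IH.
rewrite mulr_sumr -big_split; apply: eq_bigr => i _ /=.
by rewrite mderivD mderivZ rmorphD /= mmapZ; ring.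
Qed.

End Line.

(** * Positivity, monotonicity and derivatives of polynomials with nonnegative coefficients *)

Section NonnegativeCoefficients.
Context (R : realType) (n : nat).
Implicit Types (p : {mpoly R[n]}) (a b : 'I_n -> R).

Definition nnegc p := forall m : 'X_{1..n}, 0 <= p@_m.

Lemma meval_ge0 p a : nnegc p -> (forall i, 0 <= a i) -> 0 <= p.@[a].
Proof.
move=> p0 a0; rewrite mevalE; apply: sumr_ge0 => m _.
by rewrite mulr_ge0 // prodr_ge0 // => i _; rewrite exprn_ge0.
Qed.

Lemma le_meval p a b :
  nnegc p -> (forall i, 0 <= a i <= b i) -> p.@[a] <= p.@[b].
Proof.
move=> p0 ab; rewrite !mevalE; apply: ler_sum => m _.
rewrite ler_wpM2l // ler_prod // => i _.
by case/andP: (ab i) => a0 le_ab; rewrite exprn_ge0 //= lerXn2r // nnegrE // (le_trans a0).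
Qed.

Lemma meval_gt0 p a : nnegc p -> p != 0 -> (forall i, 0 < a i) -> 0 < p.@[a].
Proof.
move=> p0 pn0 a0; rewrite mevalE.
have lp := mlead_supp pn0.
rewrite (bigD1_seq _ lp (msupp_uniq p)) /=.
apply: ltr_pwDl.
  rewrite mulr_gt0 ?prodr_gt0 // => [|i _]; last by rewrite exprn_gt0.
  by rewrite lt_def p0 -mcoeff_msupp lp.
apply: sumr_ge0 => m _; rewrite mulr_ge0 // prodr_ge0 // => i _.
by rewrite exprn_ge0 // ltW.
Qed.

Lemma nnegc_mderiv p i : nnegc p -> nnegc p^`M(i).
Proof. by move=> p0 m; rewrite mcoeff_mderiv mulrn_wge0. Qed.

Lemma dhomog_mderiv d p i : p \is d.+1.-homog -> p^`M(i) \is d.-homog.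
Proof.
move=> /dhomogP hp; apply/dhomogP => m.
rewrite mcoeff_msupp mcoeff_mderiv => m0.
have mp : (m + U_(i))%MM \in msupp p.
  by rewrite mcoeff_msupp; apply: contraNneq m0 => ->; rewrite mul0rn.
have /eqP : mdeg (m + U_(i)) = d.+1 by apply: hp.
by rewrite mdegD mdeg1 addn1 eqSS => /eqP.
Qed.

Lemma mderiv_dhomog0 p i : p \is 0.-homog -> p^`M(i) = 0.
Proof.
move=> /dhomogP hp; apply/mpolyP => m; rewrite mcoeff0 mcoeff_mderiv.
rewrite memN_msupp_eq0 ?mul0rn //; apply/negP => mp.
have /eqP : mdeg (m + U_(i)) = 0%N by apply: hp.
by rewrite mdegD mdeg1 addn1.
Qed.

End NonnegativeCoefficients.

(** * Stability *)

Section Stability.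
Context (R : realType).
Import Normc.
Local Notation rc := (real_complex R).
Local Notation Re := complex.Re.
Local Notation Im := complex.Im.

Lemma ImD (x y : R[i]) : Im (x + y) = Im x + Im y.
Proof. by case: x => a b; case: y. Qed.
Lemma ImN (x : R[i]) : Im (- x) = - Im x.
Proof. by case: x. Qed.
Lemma ImMr (x : R[i]) (a : R) : Im (x * rc a) = Im x * a.
Proof. by case: x => x y /=; rewrite mulr0 add0r. Qed.
Lemma ImrM (x : R[i]) (a : R) : Im (rc a * x) = a * Im x.
Proof. by rewrite mulrC ImMr mulrC. Qed.

Lemma normc_ge0 (x : R[i]) : 0 <= normc x.
Proof. by case: x => x y; apply: sqrtr_ge0. Qed.

Lemma Im_le_normc (x : R[i]) : Im x <= normc x.
Proof.
case: x => x y /=; apply: le_trans (ler_norm y) _.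
by rewrite -sqrtr_sqr ler_wsqrtr // lerDr sqr_ge0.
Qed.

Lemma normc_real (a : R) : normc (rc a) = `|a|.
Proof. by rewrite /= expr0n /= addr0 sqrtr_sqr. Qed.

Lemma normcD_le (x y : R[i]) : normc (x + y) <= normc x + normc y.
Proof. exact: le_normcD. Qed.

Lemma normc_sum (I : Type) (r : seq I) (F : I -> R[i]) :
  normc (\sum_(i <- r) F i) <= \sum_(i <- r) normc (F i).
Proof.
elim: r => [|i r IH]; first by rewrite !big_nil normc0.
by rewrite !big_cons (le_trans (normcD_le _ _)) // lerD2l.
Qed.

Lemma normc_prod (I : Type) (r : seq I) (F : I -> R[i]) :
  normc (\prod_(i <- r) F i) = \prod_(i <- r) normc (F i).
Proof.
elim: r => [|i r IH]; first by rewrite !big_nil normc1.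
by rewrite !big_cons normcM IH.
Qed.

Lemma normcX (x : R[i]) k : normc (x ^+ k) = normc x ^+ k.
Proof. by elim: k => [|k IH]; rewrite ?expr0 ?normc1 // !exprS normcM IH. Qed.

Lemma normc_gt0 (x : R[i]) : (0 < normc x) = (x != 0).
Proof.
rewrite lt_def normc_ge0 andbT; congr (~~ _).
by apply/eqP/eqP => [/eq0_normc|->] //; rewrite normc0.
Qed.

Lemma normc_horner_small (Q : {poly R[i]}) (e : R) : 0 <= e <= 1 ->
  normc (Q.[rc e] - Q.[0]) <= e * \sum_(i < size Q) normc Q`_i.
Proof.
move=> /andP[e0 e1]; rewrite mulr_sumr.
have -> : Q.[rc e] - Q.[0] =
    \sum_(i < size Q) (if (i : nat) == 0%N then 0 else Q`_i * rc e ^+ i).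
  rewrite horner_coef0 horner_coef; case sQ: (size Q) => [|k].
    by rewrite !big_ord0 nth_default ?sQ // subr0.
  by rewrite !big_ord_recl /= expr0 mulr1 addrAC subrr !add0r.
apply: le_trans (normc_sum _ _) _; apply: ler_sum => i _.
case: ifP => [_|/negbT i0]; first by rewrite normc0 mulr_ge0 ?normc_ge0.
rewrite normcM mulrC ler_wpM2r ?normc_ge0 // normcX normc_real ger0_norm //.
by rewrite -(prednK (n := i)) ?lt0n // exprS ler_piMr // exprn_ile1.
Qed.

(** Limits enter the stability arguments only in this form: a lower bound on the modulus at small
    positive reals survives at 0. *)
Lemma normc_horner_lim (Q : {poly R[i]}) (c h : R) : 0 < h ->
  (forall e, 0 < e <= h -> c <= normc Q.[rc e]) -> c <= normc Q.[0].
Proof.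
move=> h0 cQ; set M := \sum_(i < size Q) normc Q`_i.
have M0 : 0 <= M by apply: sumr_ge0 => i _; apply: normc_ge0.
rewrite leNgt; apply/negP => lt_c.
pose d := c - normc Q.[0].
have d0 : 0 < d by rewrite subr_gt0.
pose e := Num.min (Num.min h 1) (d / (2 * (M + 1))).
have M1 : 0 < 2 * (M + 1) by lra.
have e0 : 0 < e by rewrite !lt_min h0 ltr01 divr_gt0.
have eh : e <= h by rewrite !ge_min lexx.
have e1 : e <= 1 by rewrite !ge_min lexx orbT.
have ed : e * (2 * (M + 1)) <= d by rewrite -ler_pdivlMr // ge_min lexx orbT.
have := cQ e; rewrite e0 eh => /(_ isT).
have := @normc_horner_small Q e; rewrite (ltW e0) e1 => /(_ isT).
have := normcD_le (Q.[rc e] - Q.[0]) Q.[0]; rewrite subrK -/M.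
move: ed; rewrite /d; nra.
Qed.

(** The sum of the inverse roots is minus the logarithmic derivative at 0. *)
Lemma coef1_prod_root (r : seq R[i]) : all (fun z => z != 0) r ->
  (\prod_(z <- r) ('X - z%:P))`_1 =
  - (\prod_(z <- r) ('X - z%:P))`_0 * \sum_(z <- r) z^-1.
Proof.
elim: r => [|z r IH] /=; first by rewrite !big_nil coefC mulr0.
case/andP=> z0 /IH {}IH; rewrite !big_cons.
set P := \prod_(_ <- r) _ in IH *.
rewrite !mulrBl !coefB !coefXM !coefCM /= IH sub0r opprK mulrDr mulrAC.
by rewrite mulfV // mul1r; ring.
Qed.

(** Inversion sends the open lower half plane to the open upper one, so the sum of the inverse roots
    has positive imaginary part. *)
Lemma coef1_prod_lower_root (c : R[i]) (r : seq R[i]) :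
    c != 0 -> r != [::] -> all (fun z => Im z < 0) r ->
  (c *: \prod_(z <- r) ('X - z%:P))`_1 != 0.
Proof.
move=> c0 rn0 hr.
have r0 : all (fun z => z != 0) r.
  apply: sub_all hr => z; apply: contraTneq => ->; by rewrite /= ltxx.
rewrite coefZ coef1_prod_root // !mulf_neq0 // ?oppr_eq0.
  rewrite -horner_coef0 horner_prod.
  rewrite prodf_seq_eq0 -all_predC; apply: sub_all r0 => z z0 /=.
  by rewrite hornerXsubC sub0r oppr_eq0.
suff : 0 < Im (\sum_(z <- r) z^-1).
  by apply: contraTneq => ->; rewrite ltxx.
have ImV (z : R[i]) : Im z < 0 -> 0 < Im z^-1.
  case: z => x y /= y0; rewrite -mulNr divr_gt0 ?oppr_gt0 //.
  by rewrite ltr_wpDl ?sqr_ge0 // lt_def sqr_ge0 sqrf_eq0 lt_eqF.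
case: r rn0 hr {r0} => // z r _ /= /andP[/ImV z0 hr].
rewrite big_cons ImD ltr_pwDl //.
elim: r hr => [|y r IH] /=; first by rewrite big_nil.
by case/andP=> /ImV/ltW y0 /IH; rewrite big_cons ImD; apply: addr_ge0.
Qed.

Context (n : nat).
Implicit Types (p : {mpoly R[n]}) (z : 'I_n -> R[i]).

Definition cval p z : R[i] := mmap rc z p.

(* For homogeneous p with p(a) > 0 for a > 0 this is H-stability; unlike
   "p(z) <> 0 when Im z > 0", the inequality passes to limits. *)
Definition stable p := forall z, (forall i, 0 <= Im (z i)) ->
  p.@[fun i => Im (z i)] <= normc (cval p z).

Lemma cval_real p (a : 'I_n -> R) : cval p (fun i => rc (a i)) = rc p.@[a].
Proof. by rewrite /meval rmorph_mmap; apply: mmap_eq. Qed.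

(** Homogeneity makes p(v) the coefficient of degree d, so p(v) <> 0 forces exactly d roots with
    multiplicity. *)
Lemma mline_split d p z (v : 'I_n -> R) : p \is d.-homog -> p.@[v] != 0 ->
  {r : seq R[i] | size r = d &
    mline rc p z (fun i => rc (v i)) =
      rc p.@[v] *: \prod_(x <- r) ('X - x%:P)}.
Proof.
move=> hp pv0; set Q := mline _ _ _ _.
have Qd : Q`_d = rc p.@[v] by rewrite (coef_mline _ _ _ hp) -cval_real.
have rv0 : rc p.@[v] != 0 by rewrite fmorph_eq0.
have sQ : size Q = d.+1.
  apply/anti_leq; rewrite size_mline //= ltnNge; apply: contra rv0 => le_d.
  by rewrite -Qd nth_default.
have lQ : lead_coef Q = rc p.@[v] by rewrite lead_coefE sQ.
have [r Qr] := closed_field_poly_normal Q.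
rewrite lQ in Qr; exists r => //.
by have := congr1 (size : {poly _} -> nat) Qr; rewrite sQ size_scale // size_prod_XsubC => -[].
Qed.

(** With a = Im z > 0, the roots of s |-> p(Re z + s a) have imaginary part at most 0, hence lie at
    distance at least 1 from i, and p(z) is the value at s = i. *)
Lemma stable_of_nonvanishing d p : p \is d.-homog -> nnegc p ->
  (forall z, (forall i, 0 < Im (z i)) -> cval p z != 0) -> stable p.
Proof.
move=> hp p0 nv.
have strict z : (forall i, 0 < Im (z i)) ->
    p.@[fun i => Im (z i)] <= normc (cval p z).
  move=> z0; set a := fun i => Im (z i).
  have a0 : 0 <= p.@[a] by apply: meval_ge0 => // i; apply/ltW/z0.
  have [->|pa0] := eqVneq p.@[a] 0; first exact: normc_ge0.
  have [r _ Qr] := mline_split (fun i => rc (Re (z i))) hp pa0.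
  have -> : cval p z = (mline rc p (fun i => rc (Re (z i))) (fun i => rc (a i))).['i%C].
    by rewrite horner_mline; apply: mmap_eq => // i; rewrite [LHS]complexE.
  rewrite Qr hornerZ horner_prod normcM normc_real ger0_norm //.
  rewrite ler_peMr // normc_prod.
  have hr x : x \in r -> Im x <= 0.
    move=> xr; rewrite leNgt; apply/negP => x0.
    suff /negP[] : cval p (fun i => rc (Re (z i)) + x * rc (a i)) != 0.
      rewrite /cval -horner_mline Qr hornerZ mulf_eq0; apply/orP; right.
      by rewrite -/(root _ x) root_prod_XsubC.
    by apply: nv => i; rewrite ImD ImMr /= add0r mulr_gt0 //; apply: z0.
  rewrite big_seq; apply: (big_ind (fun y => 1 <= y)) => // [x y x1 y1|x xr].
    exact: mulr_ege1.
  apply: le_trans _ (Im_le_normc _); rewrite !hornerE ImD ImN /=.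
  by have := hr _ xr; lra.
(* If some Im (z i) may vanish, z is shifted by [e 'i] and e tends to 0. *)
move=> z z0; rewrite -[cval p z]/(mmap _ _ _) -(mline0 rc p z (fun=> 'i%C)) -horner_coef0.
apply: (@normc_horner_lim _ _ 1) => // e /andP[e0 _]; rewrite horner_mline.
have Ime i : Im (z i + rc e * 'i%C) = Im (z i) + e by rewrite ImD ImrM /= mulr1.
apply: le_trans _ (strict _ _); last by move=> i; rewrite Ime; have := z0 i; lra.
by apply: le_meval => // i; rewrite Ime z0 lerDl ltW.
Qed.

Lemma cval_neq0 p z : nnegc p -> p != 0 -> stable p ->
  (forall i, 0 < Im (z i)) -> cval p z != 0.
Proof.
move=> p0 pn0 sp z0; rewrite -normc_gt0; apply: lt_le_trans (sp _ _).
  exact: meval_gt0.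
by move=> i; apply/ltW.
Qed.

(* The derivative along e_k is the limit of those along v = e_k + e 1 > 0.  All
   the roots of s |-> p (z + s v) have negative imaginary part, so that the
   logarithmic derivative at 0 has nonzero imaginary part. *)
Lemma stable_mderiv d p k : p \is d.-homog -> nnegc p -> stable p ->
  stable p^`M(k).
Proof.
have st0 : stable 0.
  by move=> z _; rewrite meval0; apply: normc_ge0.
case: d => [/mderiv_dhomog0 -> //|d hp p0 sp].
have [->|pn0] := eqVneq p 0; first by rewrite mderiv0.
pose v e i : R := (i == k)%:R + e.
pose q e : {mpoly R[n]} := \sum_i v e i *: p^`M(i).
have v0 e i : 0 < e -> 0 < v e i by move=> e0; rewrite ltr_wpDl.
have q0 e : 0 < e -> nnegc (q e).
  move=> e0 m; rewrite raddf_sum /= sumr_ge0 // => i _.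
  by rewrite mcoeffZ mulr_ge0 ?(ltW (v0 _ _ _)) // nnegc_mderiv.
have cq e z : cval (q e) z = \sum_i rc (v e i) * cval p^`M(i) z.
  by rewrite /cval raddf_sum; apply: eq_bigr => i _ /=; rewrite mmapZ.
have sq e : 0 < e -> stable (q e).
  move=> e0; apply: (@stable_of_nonvanishing d) => [||z z0]; last 1 first.
  - rewrite cq -coef1_mline.
    have pv : p.@[v e] != 0 by rewrite gt_eqF // meval_gt0 // => i; apply: v0.
    have [r sr Qr] := mline_split z hp pv.
    rewrite Qr; apply: coef1_prod_lower_root.
    + by rewrite fmorph_eq0.
    + by rewrite -size_eq0 sr.
    apply/allP => x xr; rewrite ltNge; apply/negP => x0.
    suff /negP[] : cval p (fun i => z i + x * rc (v e i)) != 0.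
      rewrite /cval -horner_mline Qr hornerZ mulf_eq0; apply/orP; right.
      by rewrite -/(root _ x) root_prod_XsubC.
    apply: cval_neq0 => // i.
    by rewrite ImD ImMr ltr_pwDl ?mulr_ge0 ?(ltW (v0 _ _ _)).
  - by apply: rpred_sum => i _; apply: dhomogZ; apply: dhomog_mderiv.
  - exact: q0.
move=> z z0.
(* The derivative along [v e] is affine in e, so it is the value at e of this polynomial. *)
pose Q := (cval p^`M(k) z)%:P + (\sum_i cval p^`M(i) z) *: 'X.
have -> : cval p^`M(k) z = Q.[0] by rewrite !hornerE.
apply: (@normc_horner_lim _ _ 1) => // e /andP[e0 _].
have -> : Q.[rc e] = cval (q e) z.
  rewrite cq !hornerE [RHS](eq_bigr (fun i => (if i == k then cval p^`M(i) z else 0)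
      + rc e * cval p^`M(i) z)) => [|i _].
    by rewrite big_split -big_mkcond big_pred1_eq /= -mulr_sumr mulrC.
  by rewrite /v rmorphD mulrDl /=; case: eqP => _; rewrite ?rmorph1 ?rmorph0 ?mul1r ?mul0r.
apply: le_trans (sq _ e0 _ z0).
rewrite /q [leRHS]raddf_sum /= (bigD1 k) //= mevalZ /v eqxx.
have d0 i : 0 <= (p^`M(i)).@[fun i => Im (z i)].
  by apply: meval_ge0 => //; apply: nnegc_mderiv.
rewrite mulrDl mul1r -addrA lerDl addr_ge0 ?mulr_ge0 ?(ltW e0) // sumr_ge0 // => i _.
by rewrite mevalZ mulr_ge0 // addr_ge0 // ltW.
Qed.

End Stability.

(** * From hyperbolicity to stability *)

Section Hyperbolicity.
Context (R : realType).
Import Normc.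
Local Notation rc := (real_complex R).
Local Notation Re := complex.Re.
Local Notation Im := complex.Im.

Lemma mmap_dhomogZ n d (S T : comNzRingType) (f : {rmorphism S -> T})
    (p : {mpoly S[n]}) (s : T) (z : 'I_n -> T) : p \is d.-homog ->
  mmap f (fun i => s * z i) p = s ^+ d * mmap f z p.
Proof.
move=> /dhomogP hp; rewrite /mmap mulr_sumr; apply: eq_big_seq => m mp.
have <- : mdeg m = d by exact: hp.
rewrite mulrCA mdegE -prodrXr /mmap1 -big_split; congr (_ * _).
by apply: eq_bigr => i _ /=; rewrite exprMn.
Qed.

(** Quantifies the distance to the roots relative to the growth of the polynomial, over the whole
    closed upper half plane at once. *)
Lemma lower_roots_bound (r : seq R[i]) : all (fun z => Im z < 0) r ->
  exists2 k : R, 0 < k & forall s, 0 <= Im s ->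
    k * (1 + normc s) ^+ size r <= normc (\prod_(x <- r) (s - x)).
Proof.
elim: r => [|x r IH] /=.
  by exists 1 => // s _; rewrite big_nil normc1 mul1r expr0.
case/andP=> x0 /IH[k k0 hk]; set b := - Im x.
have b0 : 0 < b by rewrite oppr_gt0.
have x1 := normc_ge0 x.
(* For Im s >= 0, b <= |s - x| and |s| <= |s - x| + |x| give b (1 + |s|) <= (b + 1 + |x|) |s -
   x|. *)
exists (b / (b + 1 + normc x) * k) => [|s s0].
  by rewrite mulr_gt0 // divr_gt0 //; lra.
rewrite big_cons normcM exprS mulrACA ler_pM //; last exact: hk.
- by rewrite mulr_ge0 ?divr_ge0 //; have := normc_ge0 s; lra.
- by rewrite mulr_ge0 ?exprn_ge0 ?(ltW k0) //; have := normc_ge0 s; lra.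
rewrite mulrAC ler_pdivrMr; last by lra.
have h1 : b <= normc (s - x).
  by apply: le_trans _ (Im_le_normc _); rewrite ImD ImN /b; lra.
have h2 := normcD_le (s - x) x; rewrite subrK in h2.
nra.
Qed.

(** The error grows in s like the bound of [lower_roots_bound], so that the two can be compared for
    all s simultaneously. *)
Lemma mline_continuity n d (p : {mpoly R[n]}) (a x w : 'I_n -> R[i]) :
    p \is d.-homog ->
  exists2 M : R, 0 <= M & forall (e : R) (s : R[i]), 0 <= e <= 1 ->
    normc ((mline rc p (fun i => a i + rc e * x i) w).[s] - (mline rc p a w).[s])
      <= e * M * (1 + normc s) ^+ d.
Proof.
move=> hp.
pose F : {poly {poly R[i]}} :=
  mline (polyC \o rc) p (fun i => (a i)%:P + x i *: 'X) (fun i => (w i)%:P).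
have FE e : mline rc p (fun i => a i + rc e * x i) w = map_poly (horner_eval (rc e)) F.
  rewrite rmorph_mmap; apply: mmap_eq => [c|i] /=.
    by rewrite map_polyC /= /horner_eval hornerC.
  rewrite [RHS]rmorphD /= map_polyC map_polyZ map_polyX /= /horner_eval.
  by rewrite !hornerE mulrC.
have F0 : mline rc p a w = map_poly (horner_eval (rc 0)) F.
  by rewrite -FE; apply: mmap_eq => // i; rewrite rmorph0 mul0r addr0.
pose M j := \sum_(i < size F`_j) normc F`_j`_i.
have M0 j : 0 <= M j by apply: sumr_ge0 => i _; apply: normc_ge0.
exists (\sum_(j < d.+1) M j); first exact: sumr_ge0.
move=> e s he; have [e0 _] := andP he.
rewrite !(@horner_coef_wide _ d.+1) ?size_mline // -sumrB.
apply: le_trans (normc_sum _ _) _.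
rewrite -mulrA mulr_suml mulr_sumr; apply: ler_sum => j _.
rewrite FE F0 -mulrBl normcM !coef_map /horner_eval rmorph0 mulrA.
rewrite ler_pM ?normc_ge0 ?normc_horner_small // normcX.
have s0 := normc_ge0 s.
apply: (@le_trans _ _ ((1 + normc s) ^+ j)).
  by rewrite lerXn2r ?nnegrE //; lra.
by rewrite ler_weXn2l // ?lerDl // -ltnS.
Qed.

(* Garding's homotopy: the roots of [s |-> p (t x + i e 1 + s w)] lie in the
   open lower half plane for [t = 0], and they cannot cross the real axis as
   [t] grows to 1. *)
Lemma stable_pos_hyperbolic n d (p : {mpoly R[n]}) :
  hom_plus d p -> pos_hyperbolic p -> stable p.
Proof.
case=> hp p0 [pe rootR root0].
apply: (stable_of_nonvanishing hp p0) => z z0.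
have cvE (X : 'I_n -> R) y :
    (map_mpoly rc p).@[fun i => rc (X i) - y] = cval p (fun i => rc (X i) - y).
  exact: meval_map_mpoly.
(* Splitting Im z as e 1 + w with e > 0 and w > 0 makes z the point of the homotopy at t = 1, s =
   i. *)
have [e e0 ez] : exists2 e : R, 0 < e & forall i, e < Im (z i).
  exists ((\big[Num.min/1]_i Im (z i)) / 2).
    by rewrite divr_gt0 //; apply: lt_bigmin.
  move=> i; have : \big[Num.min/1]_i Im (z i) <= Im (z i) by apply: bigmin_le.
  by have := z0 i; lra.
pose w i := Im (z i) - e; pose x i := Re (z i).
have w0 i : 0 < w i by rewrite subr_gt0.
have pn0 : p != 0 by apply: contraTneq pe => ->; rewrite meval0 ltxx.
have pw0 : 0 < p.@[w] by apply: meval_gt0.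
pose wC i := rc (w i).
have [a aE] : {a : R -> 'I_n -> R[i] | forall t i, a t i = rc (t * x i) + rc e * 'i%C}.
  by exists (fun t i => rc (t * x i) + rc e * 'i%C).
have [G Gdef] : {G : R -> {poly R[i]} | forall t, G t = mline rc p (a t) wC}.
  by exists (fun t => mline rc p (a t) wC).
have GE t s : (G t).[s] = cval p (fun i => a t i + s * wC i).
  by rewrite Gdef horner_mline.
(* If p vanished at X + i e 1, then - i e would be a non-real root. *)
have root_neg X : cval p (fun i => rc (X i) + rc e * 'i%C) != 0.
  apply/eqP => h; have : - (rc e * 'i%C) \is Num.real.
    by apply: (rootR X); rewrite cvE opprK.
  have -> : - (rc e * 'i%C) = (0 +i* (- e))%C.
    by apply/eqP; rewrite eq_complex /= !mul0r !mulr0 mulr1 subr0 oppr0 addr0 !eqxx.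
  by rewrite complex_real oppr_eq0 gt_eqF.
have Greal t u : (G t).[rc u] != 0.
  rewrite GE (_ : cval _ _ = cval p (fun i => rc (t * x i + u * w i) + rc e * 'i%C)) //.
  apply: mmap_eq => // i.
  by rewrite aE /wC [rc (_ + u * _)]rmorphD /= [rc (u * _)]rmorphM /= addrAC.
have Gsplit t : {r : seq R[i] | size r = d &
    G t = rc p.@[w] *: \prod_(y <- r) ('X - y%:P)}.
  by rewrite Gdef; apply: mline_split => //; rewrite gt_eqF.
pose bad t := exists2 s, 0 <= Im s & (G t).[s] = 0.
have lower t r : ~ bad t -> G t = rc p.@[w] *: \prod_(y <- r) ('X - y%:P) ->
    all (fun y => Im y < 0) r.
  move=> nbad Gr; apply/allP => y yr; rewrite ltNge; apply/negP => y0.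
  apply: nbad; exists y => //; rewrite Gr hornerZ.
  by have /eqP -> : root (\prod_(y <- r) ('X - y%:P)) y; rewrite ?mulr0 // root_prod_XsubC.
have normG t r s : G t = rc p.@[w] *: \prod_(y <- r) ('X - y%:P) ->
    normc (G t).[s] = p.@[w] * normc (\prod_(y <- r) (s - y)).
  move=> ->; rewrite hornerZ normcM normc_real gtr0_norm // horner_prod.
  by congr (_ * normc _); apply: eq_bigr => y _; rewrite hornerXsubC.
(* This bound does not depend on t, so it survives in the limit at the infimum of the bad times. *)
have far t s : ~ bad t -> 0 <= Im s -> p.@[w] * Im s ^+ d <= normc (G t).[s].
  move=> nbad s0; have [r sr Gr] := Gsplit t.
  rewrite (normG _ _ _ Gr) ler_pM2l // normc_prod -sr.
  have := lower _ _ nbad Gr; elim: r {sr Gr} => [|y r IH] /=.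
    by rewrite big_nil.
  case/andP=> y0 /IH hr; rewrite big_cons exprS ler_pM ?exprn_ge0 //.
  by apply: le_trans _ (Im_le_normc _); rewrite ImD ImN; lra.
(* Factoring s out of p(i e 1 + s w) makes y = - i e / s a root of p(w - y 1), hence y >= 0; but Im
   (y s) = - e < 0 while Im s >= 0. *)
have bad0 : ~ bad 0.
  case=> s s0; have [sr|sn0] := eqVneq s (rc (Re s)).
    by rewrite sr => /eqP; apply/negP.
  have sn : s != 0 by apply: contraNneq sn0 => ->.
  rewrite GE => h; pose y := - (rc e * 'i%C / s).
  have : cval p (fun i => rc (w i) - y) = 0.
    apply/eqP; suff : s ^+ d * cval p (fun i => rc (w i) - y) == 0.
      by rewrite mulf_eq0 expf_eq0 (negPf sn) andbF.
    rewrite -mmap_dhomogZ // -h; apply/eqP; apply: mmap_eq => // i.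
    rewrite aE mul0r rmorph0 add0r /y opprK mulrDr mulrC addrC; congr (_ + _).
    by rewrite mulrC divfK.
  rewrite -cvE => /(root0 _ _ (fun i => ltW (w0 i))) y0.
  have yr : y = rc (Re y) by rewrite RRe_real // ger0_real.
  have ry0 : 0 <= Re y by move: y0; rewrite yr ler0c.
  have : Im (y * s) = - e.
    by rewrite /y mulNr divfK // ImN ImrM /= mulr1.
  rewrite yr ImrM; have := mulr_ge0 ry0 s0; lra.
(* On a short interval the lower bound for G at t beats the change of G, both being of order (1 +
   |s|)^d. *)
have open t : ~ bad t -> exists2 h, 0 < h & forall t', t <= t' <= t + h -> ~ bad t'.
  move=> nbad; have [r sr Gr] := Gsplit t.
  have [k k0 hk] := lower_roots_bound (lower _ _ nbad Gr).
  have [M M0 hM] := mline_continuity (a t) (fun i => rc (x i)) wC hp.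
  pose K := p.@[w] * k.
  have K0 : 0 < K by rewrite mulr_gt0.
  have M1 : 0 < M + 1 by lra.
  exists (Num.min 1 (K / (2 * (M + 1)))).
    by rewrite lt_min ltr01 divr_gt0 // mulr_gt0.
  move=> t' /andP[le_t]; rewrite -lerBlDl le_min => /andP[t1 tK] [s s0 Gs].
  have t0 : 0 <= t' - t by rewrite subr_ge0.
  have := hM (t' - t) s; rewrite t0 t1 => /(_ isT).
  have -> : mline rc p (fun i => a t i + rc (t' - t) * rc (x i)) wC = G t'.
    rewrite Gdef; congr (mline _ _ _ _); apply/funext => i; rewrite !aE.
    by rewrite addrAC -rmorphM -rmorphD /=; congr (rc _ + _); ring.
  rewrite -Gdef Gs sub0r normcN (normG _ _ _ Gr) => h1.
  have s1 : 0 < (1 + normc s) ^+ d by rewrite exprn_gt0 //; have := normc_ge0 s; lra.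
  have := hk _ s0; rewrite sr -(ler_pM2l pw0) mulrA -/K => h2.
  have := le_trans h2 h1; rewrite ler_pM2r // => h3.
  move: tK; rewrite ler_pdivlMr ?mulr_gt0 //; nra.
(* The infimum of the bad times is itself bad, as good times extend to the right, and it is
   positive. Its root has Im s > 0, real roots being excluded, against the limit of [far] from the
   left. *)
have nbad1 : ~ bad 1.
  move=> bad1; pose B := [set t | 0 <= t /\ bad t]%classic.
  have B1 : B 1 by [].
  have lbB : has_lbound B by exists 0 => t [].
  have infB : has_inf B by split=> //; exists 1.
  have i0 : 0 <= inf B by apply: lb_le_inf => [|t []//]; exists 1.
  have before t : 0 <= t -> t < inf B -> ~ bad t.
    by move=> t0 lt_t bt; move: lt_t; rewrite ltNge ge_inf.
  have [bi|nbi] := pselect (bad (inf B)); last first.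
    have [h h0 hh] := open _ nbi.
    suff : inf B + h <= inf B by lra.
    apply: lb_le_inf; first by exists 1.
    move=> t Bt; have [t0 bt] := Bt; rewrite leNgt; apply/negP => lt_t.
    by apply: (hh t) bt; rewrite (ltW lt_t) ge_inf.
  have ip : 0 < inf B.
    by rewrite lt_def i0 andbT; apply: contra_not_neq bad0 => <-.
  case: bi => s s0 Gs.
  have sp : 0 < Im s.
    rewrite lt_def s0 andbT; apply: contra_eq_neq Gs => sI.
    suff -> : s = rc (Re s) by [].
    by case: (s) sI => u v /= ->.
  pose Q := mline rc p (fun i => a (inf B) i + s * wC i) (fun i => - rc (x i)).
  have QE u : Q.[rc u] = (G (inf B - u)).[s].
    rewrite GE horner_mline; apply: mmap_eq => // i.
    by rewrite !aE mulrBl rmorphB /= rmorphM mulrN; ring.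
  have : p.@[w] * Im s ^+ d <= normc Q.[0].
    apply: (normc_horner_lim ip) => u /andP[u0 ui].
    by rewrite QE far ?(ltW sp) //; apply: before; lra.
  have := QE 0; rewrite subr0 rmorph0 Gs => ->; rewrite normc0.
  by apply/negP; rewrite -ltNge mulr_gt0 // exprn_gt0.
apply/eqP => cz; apply: nbad1; exists 'i%C => //=.
rewrite GE -cz; apply: mmap_eq => // i.
rewrite [RHS]complexE aE /wC /w mul1r rmorphB /=; ring.
Qed.

End Hyperbolicity.

(** * Elimination of variables *)

Section Elimination.
Context (R : realType).
Import Normc.
Local Notation rc := (real_complex R).
Local Notation Re := complex.Re.
Local Notation Im := complex.Im.

Definition greal (k : nat) : R := (k.-1%:R / k%:R) ^+ k.-1.

Lemma greal_ge0 k : 0 <= greal k.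
Proof. by rewrite exprn_ge0 // divr_ge0. Qed.

Lemma greal_le1 k : greal k <= 1.
Proof.
rewrite exprn_ile1 ?divr_ge0 //; case: k => [|k]; first by rewrite invr0 mulr0.
by rewrite ler_pdivrMr ?ltr0n // mul1r ler_nat.
Qed.

Lemma greal_gt0 k : 0 < greal k.
Proof.
case: k => [|[|k]]; rewrite /greal ?expr0 ?ltr01 //.
by rewrite exprn_gt0 // divr_gt0 ?ltr0n.
Qed.

(** AM-GM over [k.+1] factors after padding s with zeros, so that the exponent is the degree bound
    rather than the number of roots. *)
Lemma prod_le_AGM (s : seq R) (k : nat) (t : R) :
    (size s <= k.+1)%N -> 0 <= t -> all (fun a => 0 <= a) s ->
  \prod_(a <- s) (1 + t * a) <= (1 + t * (\sum_(a <- s) a) / k.+1%:R) ^+ k.+1.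
Proof.
move=> sk t0 s0.
have nth0 i : 0 <= s`_i.
  have [lt_i|le_i] := ltnP i (size s); last by rewrite nth_default.
  exact: (all_nthP 0 s0).
pose E (i : 'I_k.+1) := 1 + t * s`_i.
have E0 : {in 'I_k.+1, forall i, 0 <= E i}.
  by move=> i _; rewrite addr_ge0 ?mulr_ge0.
have [AG _] := leif_AGM E0.
have widen (T : Type) (idx : T) (op : Monoid.law idx) (F : R -> T) : F 0 = idx ->
    \big[op/idx]_(a <- s) F a = \big[op/idx]_(i < k.+1) F s`_i.
  move=> F0; rewrite (big_nth 0) big_mkord (big_ord_widen _ (fun i => F s`_i) sk).
  rewrite big_mkcond; apply: eq_bigr => i _; case: ltnP => // le_i.
  by rewrite nth_default.
rewrite (widen _ _ _ (fun a => 1 + t * a)) ?mulr0 ?addr0 //.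
rewrite (widen _ _ _ id) //.
apply: le_trans AG _; rewrite card_ord big_split /= sumr_const card_ord -mulr_sumr.
by rewrite mulrDl divff ?pnatr_eq0.
Qed.

(** If Q(0) > 0, real roots and nonnegative coefficients give Q(t) = Q(0) prod (1 + t a) with all a
    > 0. Then Q'(0) = Q(0) S, where S is the sum of the a, and AM-GM bounds C t by Q(0) (1 + t S /
    k)^k. *)
Lemma deriv0_ge_greal (Q : {poly R}) (k : nat) (C : R) :
    (forall i, 0 <= Q`_i) -> (size Q <= k.+1)%N ->
    (Q != 0 -> forall u, root (map_poly rc Q) u -> Im u = 0) ->
    (forall t, 0 < t -> C * t <= Q.[t]) ->
  greal k * C <= Q`_1.
Proof.
move=> Q0 sQ Qreal hC.
have [C0|C0] := leP C 0.
  by rewrite (le_trans _ (Q0 _)) // mulr_ge0_le0 // greal_ge0.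
have Qn0 : Q != 0.
  by apply: contraTneq (hC 1 ltr01) => ->; rewrite horner0 mulr1 -ltNge.
have unbounded B : (forall t, 0 < t -> C * t <= B) -> False.
  move=> hB; have B0 : 0 <= B.
    by apply: le_trans (hB 1 ltr01); rewrite mulr1 ltW.
  have := hB ((B + 1) / C); rewrite divr_gt0 // ?ltr_wpDl // => /(_ isT).
  by rewrite mulrC divfK ?gt_eqF //; lra.
(* If Q = t q, then C <= q(t) for all t > 0, and q(0) = Q'(0) is the limit. *)
have [Q00|Q00] := eqVneq Q`_0 0.
  have /factor_theorem[q Qq] : root Q 0 by rewrite rootE horner_coef0 Q00.
  rewrite subr0 in Qq.
  have -> : Q`_1 = q`_0 by rewrite Qq coefMX.
  apply: (@le_trans _ _ C); first by rewrite ler_piMl ?greal_le1 // ltW.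
  have q0 : 0 <= q`_0 by have := Q0 1%N; rewrite Qq coefMX.
  have -> : q`_0 = normc (map_poly rc q).[0].
    by rewrite -(rmorph0 rc) horner_map normc_real horner_coef0 ger0_norm.
  apply: (@normc_horner_lim _ _ _ 1) => // e /andP[e0 _].
  rewrite horner_map normc_real (le_trans _ (ler_norm _)) // -(ler_pM2r e0).
  by have := hC e e0; rewrite Qq hornerMX.
have Q0p : 0 < Q`_0 by rewrite lt_def Q00 Q0.
have [r Qr] := closed_field_poly_normal (map_poly rc Q).
set c := lead_coef _ in Qr.
have c0 : c != 0 by rewrite lead_coef_eq0 map_poly_eq0.
have sr : (size r <= k)%N.
  have := congr1 (size : {poly _} -> nat) Qr.
  by rewrite size_map_poly size_scale // size_prod_XsubC => sr; rewrite sr in sQ.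
have rr z : z \in r -> exists2 a, 0 < a & z = rc (- a^-1).
  move=> zr; have rz : root (map_poly rc Q) z.
    by rewrite Qr rootZ // root_prod_XsubC.
  have zE : z = rc (Re z).
    by have := Qreal Qn0 z rz; case: (z) => u v /= ->.
  have z0 : Re z < 0.
    rewrite ltNge; apply/negP => z0.
    have /eqP : (map_poly rc Q).[rc (Re z)] = 0 by rewrite -zE; apply/eqP.
    rewrite horner_map fmorph_eq0 /=; apply/negP.
    rewrite horner_coef; case sQ': (size Q) => [|m].
      by move/eqP: sQ'; rewrite size_poly_eq0 (negPf Qn0).
    rewrite big_ord_recl expr0 mulr1 gt_eqF // ltr_pwDl // sumr_ge0 // => i _.
    by rewrite mulr_ge0 // exprn_ge0.
  exists (- (Re z)^-1); first by rewrite oppr_gt0 invr_lt0.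
  by rewrite invrN invrK opprK.
have [s sE s0] : exists2 s, r = [seq rc (- a^-1) | a <- s] & all (fun a : R => 0 < a) s.
  elim: (r) rr => [|z r' IH] hr; first by exists [::].
  have [a a0 za] := hr z (mem_head _ _).
  have [|s -> s0] := IH; first by move=> y yr; apply: hr; rewrite inE yr orbT.
  by exists (a :: s); rewrite /= ?za ?a0.
have s00 : all (fun a : R => 0 <= a) s by apply: sub_all s0 => a; apply: ltW.
pose S := \sum_(a <- s) a.
have QP t : Q.[t] = Q`_0 * \prod_(a <- s) (1 + t * a).
  apply: (fmorph_inj rc); rewrite rmorphM rmorph_prod -horner_map /=.
  have -> : rc Q`_0 = (map_poly rc Q).[0] by rewrite horner_coef0 coef_map.
  rewrite Qr !hornerZ -mulrA; congr (_ * _); rewrite !horner_prod sE !big_map -big_split.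
  apply: eq_big_seq => a /(allP s0) a0 /=; rewrite !hornerXsubC -!rmorphB -?rmorphM /=.
  by rewrite sub0r !opprK mulrDr mulr1 mulrCA mulVf ?gt_eqF // mulr1 addrC.
have Q1 : Q`_1 = Q`_0 * S.
  apply: (fmorph_inj rc); rewrite rmorphM /= -!coef_map Qr !coefZ.
  rewrite coef1_prod_root; last first.
    apply/allP => z /rr[a a0 ->]; by rewrite fmorph_eq0 oppr_eq0 invr_eq0 gt_eqF.
  rewrite mulNr -mulrN mulrA; congr (_ * _).
  rewrite sE big_map -sumrN rmorph_sum; apply: eq_bigr => a _ /=.
  by rewrite -fmorphV -rmorphN /= invrN invrK opprK.
have ss : (size s <= k)%N by rewrite -(size_map (fun a => rc (- a^-1))) -sE.
have S0 : 0 <= S.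
  by rewrite /S big_seq; apply: sumr_ge0 => a; apply: (allP s00).
case: k sQ sr ss => [|k] sQ sr ss.
  exfalso; apply: (unbounded Q`_0) => t t0; apply: le_trans (hC t t0) _.
  by rewrite QP; case: (s) ss => // _; rewrite big_nil mulr1.
have hAG t : 0 < t -> C * t <= Q`_0 * (1 + t * S / k.+1%:R) ^+ k.+1.
  move=> t0; apply: le_trans (hC t t0) _; rewrite QP ler_pM2l //.
  by apply: prod_le_AGM => //; apply: ltW.
have Sp : 0 < S.
  rewrite lt_def S0 andbT; apply: contra_notN (unbounded Q`_0) => /eqP S00 t t0.
  by have := hAG t t0; rewrite S00 mulr0 mul0r addr0 expr1n mulr1.
(* For degree bound 1 the best constant is only approached as t tends to infinity, so a large t is
   used. *)
case: k hAG {sQ sr ss} => [|k] hAG.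
  rewrite /greal expr0 mul1r leNgt; apply/negP => lt_C.
  have d0 : 0 < C - Q`_1 by rewrite subr_gt0.
  have := hAG ((Q`_0 + 1) / (C - Q`_1)); rewrite divr_gt0 // ?ltr_wpDl // => /(_ isT).
  set t := _ / _ => ht; have : (C - Q`_1) * t = Q`_0 + 1.
    by rewrite mulrC divfK // gt_eqF.
  by move: ht; rewrite expr1 divr1 Q1; lra.
have k1 : 0 < k.+1%:R :> R by rewrite ltr0n.
have k2 : 0 < k.+2%:R :> R by rewrite ltr0n.
(* With degree bound d = [k.+2], this t = d / ((d - 1) S) minimizes (1 + t S / d)^d / t. *)
have := hAG (k.+2%:R / (k.+1%:R * S)); rewrite divr_gt0 ?mulr_gt0 // => /(_ isT).
have -> : 1 + k.+2%:R / (k.+1%:R * S) * S / k.+2%:R = k.+2%:R / k.+1%:R :> R.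
  have k12 : k.+2%:R = 1 + k.+1%:R :> R by rewrite -natr1 addrC.
  rewrite k12; move: k1; set a := k.+1%:R => a0.
  have a1 : 1 + a != 0 by rewrite gt_eqF // ltr_pwDl.
  by field; do ?[apply/andP; split]; rewrite ?gt_eqF //; lra.
rewrite /greal -pred_Sn -[k.+1%:R / k.+2%:R]invf_div exprVn.
set u := k.+2%:R / k.+1%:R; have u0 : 0 < u by rewrite divr_gt0.
rewrite ler_pdivrMl ?exprn_gt0 // Q1.
have -> : k.+2%:R / (k.+1%:R * S) = u / S by rewrite invfM mulrA.
move=> h; rewrite -(ler_pM2r (divr_gt0 u0 Sp)); apply: le_trans h _.
rewrite exprS le_eqVlt; apply/orP; left; apply/eqP; field; exact: lt0r_neq0.
Qed.

Section Step.
Context (n : nat).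
Implicit Types (p : {mpoly R[n]}) (x y : 'I_n -> R).

Definition setv x k t : 'I_n -> R := fun i => if i == k then t else x i.

Definition degree_bound p (D : 'I_n -> nat) :=
  forall m i, m \in msupp p -> (m i <= D i)%N.

Lemma coef_prod_ge0 (I : Type) (r : seq I) (F : I -> {poly R}) :
  (forall i k, 0 <= (F i)`_k) -> forall k, 0 <= (\prod_(i <- r) F i)`_k.
Proof.
move=> F0; elim: r => [|i r IH] k; first by rewrite big_nil coefC; case: ifP.
by rewrite big_cons coefM sumr_ge0 // => j _; rewrite mulr_ge0.
Qed.

(** As a function of the k-th coordinate, p has degree at most [D k] and at most d, and is
    real-rooted by stability, so the one-variable bound applies. *)
Lemma greal_mderiv p d k x (D : 'I_n -> nat) (C : R) :
    p \is d.-homog -> nnegc p -> stable p -> degree_bound p D ->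
    (forall i, 0 <= x i) ->
    (forall t, 0 < t -> C * t <= p.@[setv x k t]) ->
  greal (minn (D k) d) * C <= p^`M(k).@[setv x k 0].
Proof.
move=> hp p0 sp hD x0 hC.
pose x' := setv x k 0; pose v i : R := (i == k)%:R.
have x'0 i : 0 <= x' i by rewrite /x' /setv; case: ifP.
pose Q := mline idfun p x' v.
have QE t : Q.[t] = p.@[setv x k t].
  rewrite horner_mline; apply: mmap_eq => // i; rewrite /x' /v /setv.
  by case: eqP => _; rewrite ?mulr1 ?add0r ?mulr0 ?addr0.
have Q0 i : 0 <= Q`_i.
  rewrite /Q /mline /mmap coef_sum sumr_ge0 // => m _.
  rewrite /= mul_polyC coefZ mulr_ge0 //; apply: coef_prod_ge0 => l j.
  rewrite -[m l]card_ord -prodr_const; apply: coef_prod_ge0 => _ {}j.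
  rewrite coefD coefC coefZ coefX /v addr_ge0 ?mulr_ge0 ?ler0n //.
  by case: ifP.
have sQ : (size Q <= (D k).+1)%N.
  rewrite /Q /mline /mmap (leq_trans (size_sum _ _ _)) //.
  apply/bigmax_leqP_seq => m mp _ /=.
  rewrite mul_polyC (leq_trans (size_scale_leq _ _)) //.
  have sm i : (size (((x' i)%:P + v i *: 'X) ^+ m i) <= (if i == k then m i else 0).+1)%N.
    rewrite /v; case: eqP => [_|_]; first exact: proj1 (size_expD1 _ (size_affine _ _)).
    by rewrite scale0r addr0 -polyC_exp size_polyC_leq1.
  have [le_s _] := top_prod (index_enum 'I_n) sm.
  apply: leq_trans le_s _; rewrite ltnS -big_mkcond big_pred1_eq.
  exact: hD.
have -> : p^`M(k).@[setv x k 0] = Q`_1.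
  rewrite coef1_mline (bigD1 k) //= /v eqxx mul1r big1 ?addr0 // => i /negPf ->.
  by rewrite mul0r.
apply: deriv0_ge_greal => // [|Qn0 u ru|t /hC]; last by rewrite QE.
  by rewrite -minnSS leq_min sQ size_mline.
apply/eqP; apply: contraNT Qn0 => u0.
have mQ : map_poly rc Q = mline rc p (fun i => rc (x' i)) (fun i => rc (v i)).
  rewrite /Q rmorph_mmap; apply: mmap_eq => [c|i] /=; first by rewrite map_polyC.
  by rewrite rmorphD /= map_polyC map_polyZ map_polyX.
move: ru; rewrite mQ rootE horner_mline => /eqP ru.
(* For a non-real root u some factor z takes both 1 and u into the open upper half plane. By
   homogeneity the zero can be scaled by z, and stability yields p(y) <= 0 at a point with y k > 0,
   which forces Q = 0. *)
have [z z0 zu0] : exists2 z : R[i], 0 < Im z & 0 < Im (z * u).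
  case: u u0 {ru} => a b /= b0; have [bp|bn] := ltP 0 b.
    exists ((1 - a) +i* b)%C => //=; lra.
  have {}bn : b < 0 by rewrite lt_neqAle b0.
  exists ((a - 1) +i* (- b))%C => /=; lra.
have hz : cval p (fun i => z * (rc (x' i) + u * rc (v i))) = 0.
  by rewrite /cval (mmap_dhomogZ _ _ _ hp) ru mulr0.
pose y := setv (fun i => Im z * x i) k (Im (z * u)).
have : p.@[y] <= 0.
  have := sp (fun i => z * (rc (x' i) + u * rc (v i))).
  rewrite hz normc0.
  have yE i : Im (z * (rc (x' i) + u * rc (v i))) = y i.
    rewrite /x' /v /y /setv mulrDr ImD mulrA !ImMr.
    by case: eqP => _; rewrite ?mulr1 ?mulr0 ?add0r ?addr0.
  rewrite (meval_eq p yE); apply => i; rewrite yE /y /setv.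
  by case: ifP => _; rewrite ?mulr_ge0 ?(ltW z0) ?(ltW zu0).
have yE i : y i = Im z * setv x k (Im (z * u) / Im z) i.
  by rewrite /y /setv; case: eqP => // _; rewrite [RHS]mulrC divfK // gt_eqF.
rewrite /meval (mmap_eq p (fun=> erefl) yE) (mmap_dhomogZ idfun _ _ hp).
rewrite pmulr_rle0 ?exprn_gt0 //.
rewrite -[mmap _ _ _]/(p.@[_]) -QE => Qle.
set t := _ / _ in Qle; have t0 : 0 < t by rewrite divr_gt0.
apply/eqP/polyP => i; rewrite coef0; apply/eqP.
have [lt_i|le_i] := ltnP i (size Q); last by rewrite nth_default.
move: Qle; rewrite horner_coef (bigD1 (Ordinal lt_i)) //=.
have : 0 <= \sum_(j < size Q | j != Ordinal lt_i) Q`_j * t ^+ j.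
  by apply: sumr_ge0 => j _; rewrite mulr_ge0 ?exprn_ge0 ?(ltW t0).
have := mulr_ge0 (Q0 i) (exprn_ge0 i (ltW t0)) => h1 h2 h3.
have : Q`_i * t ^+ i == 0 by rewrite eq_le h1 andbT; lra.
by rewrite mulf_eq0 expf_eq0 (gt_eqF t0) andbF orbF.
Qed.

Fixpoint gprod (D : 'I_n -> nat) (d : nat) (s : seq 'I_n) : R :=
  if s is a :: s' then greal (minn (D a) d) * gprod D d.-1 s' else 1.

Lemma dhomog_mderiv_pred d p i : p \is d.-homog -> p^`M(i) \is d.-1.-homog.
Proof.
case: d => [hp|d]; last exact: dhomog_mderiv.
by rewrite mderiv_dhomog0 // rpred0.
Qed.

Lemma degree_bound_mderiv p k D : degree_bound p D -> degree_bound p^`M(k) D.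
Proof.
move=> hD m i; rewrite mcoeff_msupp mcoeff_mderiv => m0.
apply: leq_trans (hD (m + U_(k))%MM i _); first by rewrite mnmDE leq_addr.
by rewrite mcoeff_msupp; apply: contraNneq m0 => ->; rewrite mul0rn.
Qed.

(* Eliminating a variable replaces p by its partial derivative, evaluated at
   points where that coordinate vanishes; the number of variables is kept. *)
Lemma gprod_foldl_mderiv s : forall p d D x (C : R), uniq s ->
    p \is d.-homog -> nnegc p -> stable p -> degree_bound p D ->
    (forall i, 0 <= x i) ->
    (forall y, (forall i, i \in s -> 0 < y i) -> (forall i, i \notin s -> y i = x i) ->
      C * \prod_(i <- s) y i <= p.@[y]) ->
  gprod D d s * C <=
    (foldl (fun q i => q^`M(i)) p s).@[fun i => if i \in s then 0 else x i].
Proof.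
elim: s => [|a s IH] p d D x C /=.
  move=> _ hp p0 sp hD x0 hC.
  by have := hC x; rewrite big_nil mulr1 mul1r; apply.
case/andP=> as_ us hp p0 sp hD x0 hC.
have -> : greal (minn (D a) d) * gprod D d.-1 s * C =
    gprod D d.-1 s * (greal (minn (D a) d) * C) by ring.
rewrite (meval_eq (v2 := fun i => if i \in s then 0 else setv x a 0 i)); last first.
  by move=> i; rewrite inE /setv; case: (i \in s); case: (i == a).
apply: IH => //.
- exact: dhomog_mderiv_pred.
- exact: nnegc_mderiv.
- exact: stable_mderiv hp p0 sp.
- exact: degree_bound_mderiv.
- by move=> i; rewrite /setv; case: ifP.
move=> y ys yx; rewrite -mulrA.
have ya : y a = 0 by rewrite yx // /setv eqxx.
have yE : y =1 setv y a 0.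
  by move=> i; rewrite /setv; case: eqP => [->|].
rewrite (meval_eq _ yE); apply: greal_mderiv hp p0 sp hD _ _.
  move=> i; have [/ys/ltW //|/yx ->] := boolP (i \in s).
  by rewrite /setv; case: ifP.
move=> t t0; have := hC (setv y a t); rewrite big_cons.
have -> : \prod_(j <- s) setv y a t j = \prod_(j <- s) y j.
  apply: eq_big_seq => j js; rewrite /setv; case: eqP => // ja.
  by rewrite -ja js in as_.
have -> : setv y a t a = t by rewrite /setv eqxx.
rewrite mulrCA mulrC; apply.
  by move=> i; rewrite inE /setv; case: eqP => //= _; apply: ys.
move=> i; rewrite inE negb_or => /andP[/negPf ia is_].
by rewrite /setv ia yx // /setv ia.
Qed.

End Step.

End Elimination.

(** * Capacity *)

Section Compactness.
Local Open Scope classical_set_scope.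
Context (R : realType) (n : nat).

Lemma cvg_prodR (T I : Type) (G : set_system T) (FG : Filter G) (r : seq I)
    (F : I -> T -> R) (l : I -> R) :
  (forall i, F i x @[x --> G] --> l i) ->
  \prod_(i <- r) F i x @[x --> G] --> \prod_(i <- r) l i.
Proof.
move=> cF; elim: r => [|i r IH].
  by rewrite big_nil; under eq_cvg do rewrite big_nil; apply: cvg_cst.
by rewrite big_cons; under eq_cvg do rewrite big_cons; apply: cvgM.
Qed.

Lemma cvg_sumR (T I : Type) (G : set_system T) (FG : Filter G) (r : seq I)
    (F : I -> T -> R) (l : I -> R) :
  (forall i, F i x @[x --> G] --> l i) ->
  \sum_(i <- r) F i x @[x --> G] --> \sum_(i <- r) l i.
Proof.
move=> cF; elim: r => [|i r IH].
  by rewrite big_nil; under eq_cvg do rewrite big_nil; apply: cvg_cst.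
by rewrite big_cons; under eq_cvg do rewrite big_cons; apply: cvgD.
Qed.

Lemma cvg_expn (T : Type) (G : set_system T) (FG : Filter G)
    (F : T -> R) (k : nat) (l : R) :
  F x @[x --> G] --> l -> F x ^+ k @[x --> G] --> l ^+ k.
Proof.
move=> cF; elim: k => [|k IH].
  by rewrite expr0; under eq_cvg do rewrite expr0; apply: cvg_cst.
by rewrite exprS; under eq_cvg do rewrite exprS; apply: cvgM.
Qed.

(* The vanishing product says that some coordinate is 1 or -1. *)
Definition cube_shell (v : 'rV[R]_n) :=
  [/\ forall i, -1 <= v ord0 i <= 1, \sum_i v ord0 i = 0
    & \prod_i (v ord0 i ^+ 2 - 1) = 0].

(** The shell is compact, so a continuous function exceeding c on it does so by a margin. *)
Lemma meval_min_cube_shell (p : {mpoly R[n]}) (y : 'I_n -> R) (c : R) :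
  (forall v, cube_shell v -> c < p.@[fun i => y i * expR (v ord0 i)]) ->
  exists2 c', c < c' &
    forall v, cube_shell v -> c' <= p.@[fun i => y i * expR (v ord0 i)].
Proof.
move=> hc; pose f (v : 'rV[R]_n) := p.@[fun i => y i * expR (v ord0 i)].
have cc i (v : 'rV[R]_n) : (fun x : 'rV[R]_n => x ord0 i) @ v --> v ord0 i.
  exact: coord_continuous.
have cf : continuous f.
  have -> : f = fun v => \sum_(m <- msupp p) p@_m * \prod_i (y i * expR (v ord0 i)) ^+ m i.
    by apply/funext => v; exact: mevalE.
  move=> v; have Fv := nbhs_filter v.
  apply: (cvg_sumR Fv) => m; apply: (cvgM (FF := Fv)).
    exact: (@cvg_cst _ _ _ _ Fv).
  apply: (cvg_prodR Fv) => i; apply: (cvg_expn Fv); apply: (cvgM (FF := Fv)).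
    exact: (@cvg_cst _ _ _ _ Fv).
  by apply: cvg_comp (cc i v) _; exact: continuous_expR.
pose K : set 'rV[R]_n := [set v | cube_shell v].
have KE : K = [set v : 'rV[R]_n | forall i, `[-1, 1]%classic (v ord0 i)] `&`
    ((fun v : 'rV[R]_n => \sum_i v ord0 i) @^-1` [set x | x = 0] `&`
     (fun v : 'rV[R]_n => \prod_i (v ord0 i ^+ 2 - 1)) @^-1` [set x | x = 0]).
  rewrite predeqE => v; split=> [[h1 h2 h3]|[h1 [h2 h3]]].
    by split; [move=> i; rewrite /= in_itv; apply: h1|split].
  by split=> // i; have := h1 i; rewrite /= in_itv.
have cK : compact K.
  rewrite KE; apply: compact_closedI.
    have := @rV_compact R n (fun=> `[-1, 1]%classic).
    by apply=> i; apply: segment_compact.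
  apply: closedI; apply: preimage_closed; try exact: closed_eq.
    by move=> v _; apply: (cvg_sumR (nbhs_filter v)) => i; apply: cc.
  move=> v _; have Fv := nbhs_filter v.
  apply: (cvg_prodR Fv) => i; apply: (cvgB (FF := Fv)).
    by apply: (cvg_expn Fv); apply: cc.
  exact: (@cvg_cst _ _ _ _ Fv).
have [K0|] := pselect (K !=set0); last first.
  move=> K0; exists (c + 1) => [|v Kv]; first by rewrite ltrDl.
  by case: K0; exists v.
have [|v Kv hv] := EVT_min_rV K0 cK (f := f); first exact: continuous_subspaceT.
exists (f v); first by apply: hc; rewrite inE in Kv.
by move=> w Kw; apply: hv; rewrite inE.
Qed.

End Compactness.

(** * Convexity in logarithmic coordinates and growth away from the minimizer *)

Section Capacity.
Context (R : realType) (n : nat).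
Implicit Types (p : {mpoly R[n]}) (x y u : 'I_n -> R).

Lemma prodf_setv x i t (m : 'X_{1..n}) :
  \prod_j setv x i (x i * t) j ^+ m j = (\prod_j x j ^+ m j) * t ^+ m i.
Proof.
rewrite (bigD1 i) //= [in RHS](bigD1 i) //= /setv eqxx exprMn -!mulrA; congr (_ * _).
rewrite mulrC; congr (_ * _); apply: eq_bigr => j /negPf ji.
by rewrite ji.
Qed.

Lemma le_mcoeff_meval p x m : nnegc p -> (forall i, 0 <= x i) ->
  p@_m * \prod_i x i ^+ m i <= p.@[x].
Proof.
move=> p0 x0; have pr0 m' : 0 <= \prod_i x i ^+ m' i.
  by rewrite prodr_ge0 // => i _; rewrite exprn_ge0.
have [mp|mp] := boolP (m \in msupp p); last first.
  by rewrite memN_msupp_eq0 // mul0r meval_ge0.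
rewrite mevalE (bigD1_seq m) //= lerDl sumr_ge0 // => m' _.
by rewrite mulr_ge0.
Qed.

(* x_i d_i p(x) / p(x), the mean of m_i when the monomial x^m is weighted by its
   share of p(x). *)
Definition moment p x i : R :=
  (\sum_(m <- msupp p) p@_m * (\prod_j x j ^+ m j) * (m i)%:R) / p.@[x].

(** The tangent inequality of the convex function log p(exp u): exp B >= exp A (1 + B - A) on each
    monomial, and the terms B - A average to zero under the weights. *)
Lemma tangent_le p x u : nnegc p -> (forall i, 0 <= x i) -> 0 < p.@[x] ->
  p.@[x] * expR (\sum_i moment p x i * u i) <= p.@[fun i => x i * expR (u i)].
Proof.
move=> p0 x0 px0; set A := \sum_i _.
pose w (m : 'X_{1..n}) := p@_m * \prod_j x j ^+ m j.
pose B (m : 'X_{1..n}) := \sum_i (m i)%:R * u i.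
have w0 m : 0 <= w m.
  by rewrite mulr_ge0 // prodr_ge0 // => i _; rewrite exprn_ge0.
have -> : p.@[fun i => x i * expR (u i)] = \sum_(m <- msupp p) w m * expR (B m).
  rewrite mevalE; apply: eq_bigr => m _; rewrite -mulrA; congr (_ * _).
  rewrite expR_sum -big_split; apply: eq_bigr => i _ /=.
  by rewrite exprMn expRM_natl.
have sw : \sum_(m <- msupp p) w m = p.@[x] by rewrite mevalE.
have sB : \sum_(m <- msupp p) w m * B m = p.@[x] * A.
  rewrite /A mulr_sumr; under eq_bigr do rewrite mulr_sumr.
  rewrite exchange_big; apply: eq_bigr => i _ /=.
  rewrite /moment [in RHS]mulrA [p.@[x] * _]mulrC divfK ?gt_eqF // mulr_suml.
  by apply: eq_bigr => m _; rewrite mulrA.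
have -> : p.@[x] * expR A = \sum_(m <- msupp p) w m * (expR A * (1 + (B m - A))).
  rewrite [RHS](eq_bigr (fun m => (expR A * (1 - A)) * w m + expR A * (w m * B m))).
    by rewrite big_split -!mulr_sumr sw sB /=; ring.
  by move=> m _; ring.
apply: ler_sum => m _; rewrite ler_wpM2l //.
have -> : expR (B m) = expR A * expR (B m - A) by rewrite -expRD addrC subrK.
by rewrite ler_wpM2l ?expR_ge0 ?expR_ge1Dx.
Qed.

(** Euler's identity for homogeneous polynomials, divided by p(x). *)
Lemma sum_moment d p x : p \is d.-homog -> 0 < p.@[x] ->
  \sum_i moment p x i = d%:R.
Proof.
move=> /dhomogP hp px0; rewrite -mulr_suml exchange_big /=.
apply: (@mulIf _ p.@[x]); first by rewrite gt_eqF.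
rewrite divfK ?gt_eqF // mevalE mulr_sumr; apply: eq_big_seq => m mp.
have <- : mdeg m = d by exact: hp.
by rewrite -mulr_sumr mdegE natr_sum mulrC.
Qed.

Lemma expr1D_le (s : R) k : 0 <= s -> k%:R * s <= 1 ->
  (1 + s) ^+ k <= 1 + k%:R * s + k%:R ^+ 2 * s ^+ 2.
Proof.
move=> s0; elim: k => [|k IH] ks; first by rewrite expr0 expr0n /= !mul0r !addr0.
have k0 : 0 <= k%:R :> R by [].
rewrite -natr1 in ks *; have {}IH := IH ltac:(nra).
rewrite exprS; apply: le_trans (ler_wpM2l _ IH) _; first by lra.
have : k%:R * s <= 1 by nra.
nra.
Qed.

Lemma moment_ge d p x i (s : R) : p \is d.-homog -> nnegc p ->
    (forall j, 0 <= x j) -> 0 < p.@[x] -> 0 <= s -> d%:R * s <= 1 ->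
  p.@[setv x i (x i * (1 + s))] <=
    p.@[x] * (1 + moment p x i * s + d%:R ^+ 2 * s ^+ 2).
Proof.
move=> /dhomogP hp p0 x0 px0 s0 ds.
have -> : p.@[x] * (1 + moment p x i * s + d%:R ^+ 2 * s ^+ 2) =
    \sum_(m <- msupp p) p@_m * (\prod_j x j ^+ m j) *
      (1 + (m i)%:R * s + d%:R ^+ 2 * s ^+ 2).
  rewrite [RHS](eq_bigr (fun m : 'X_{1..n} =>
    (1 + d%:R ^+ 2 * s ^+ 2) * (p@_m * \prod_j x j ^+ m j) +
    s * (p@_m * (\prod_j x j ^+ m j) * (m i)%:R))); last by move=> m _; ring.
  rewrite big_split -!mulr_sumr -mevalE /= /moment.
  set S := \sum_(_ <- _) _; field; exact: lt0r_neq0.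
rewrite mevalE big_seq [leRHS]big_seq; apply: ler_sum => m mp.
rewrite prodf_setv mulrA ler_wpM2l //.
  by rewrite mulr_ge0 // prodr_ge0 // => j _; rewrite exprn_ge0.
have md : (m i <= d)%N.
  have <- : mdeg m = d by exact: hp.
  by rewrite mdegE (bigD1 i) //= leq_addr.
have md' : (m i)%:R <= d%:R :> R by rewrite ler_nat.
apply: le_trans (expr1D_le s0 _) _; first by apply: le_trans ds; rewrite ler_wpM2r.
by rewrite lerD2l ler_wpM2r ?sqr_ge0 // lerXn2r ?nnegrE.
Qed.

Lemma exists_root_prod x : (forall i, 0 < x i) ->
  exists2 l : R, 0 < l & l ^+ n = \prod_i x i.
Proof.
move=> x0; have P0 : 0 < \prod_i x i by apply: prodr_gt0.
exists (expR (ln (\prod_i x i) / n%:R)); first exact: expR_gt0.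
rewrite -expRM_natl; case: n x x0 P0 => [|k] x x0 P0.
  by rewrite mul0r expR0 big_ord0.
by rewrite mulrC divfK ?pnatr_eq0 // lnK.
Qed.

Lemma meval_scale p x (l : R) : p \is n.-homog ->
  p.@[fun i => l * x i] = l ^+ n * p.@[x].
Proof. exact: (mmap_dhomogZ idfun). Qed.

Lemma capacity_has_lbound p : nnegc p ->
  has_lbound [set p.@[(x : 'rV[R]_n) 0] | x in unit_prod R n]%classic.
Proof.
move=> p0; exists 0 => _ [x [x0 _] <-]; apply: meval_ge0 => // i.
exact: ltW.
Qed.

(** Dividing x by its geometric mean brings it into [unit_prod], and homogeneity restores the
    factor. *)
Lemma capacity_le p x : hom_plus n p -> (forall i, 0 < x i) ->
  capacity p * \prod_i x i <= p.@[x].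
Proof.
move=> [hp p0] x0; have [l l0 lE] := exists_root_prod x0.
have -> : p.@[x] = l ^+ n * p.@[(\row_i (x i / l)) 0].
  rewrite -meval_scale //; apply: meval_eq => i.
  by rewrite mxE mulrC divfK // gt_eqF.
rewrite -lE mulrC ler_wpM2l ?exprn_ge0 ?(ltW l0) //.
apply: ge_inf; first exact: capacity_has_lbound.
exists (\row_i (x i / l)) => //; split=> [i|].
  by rewrite mxE divr_gt0.
under eq_bigr do rewrite mxE.
by rewrite prodf_div prodr_const card_ord -lE divff // expf_neq0 // gt_eqF.
Qed.

(** Uniqueness makes p exceed its capacity by a factor exp d on the shell max |u i| = 1; convexity
    along rays turns this into exponential growth. *)
Lemma capacity_growth p : hom_plus n p -> p != 0 -> indecomposable p ->
  exists (y : 'I_n -> R) (d : R),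
    [/\ forall i, 0 < y i, \prod_i y i = 1, p.@[y] = capacity p, 0 < d &
      forall u (r : R), 1 <= r -> \sum_i u i = 0 -> (forall i, `|u i| <= r) ->
        (exists i, `|u i| = r) ->
        capacity p * expR (d * r) <= p.@[fun i => y i * expR (u i)]].
Proof.
move=> hp pn0 [y [[[y0 y1] yc] uy]]; have [hom p0] := hp.
have c0 : 0 < capacity p by rewrite -yc; apply: meval_gt0.
have prodE (v : 'I_n -> R) : \sum_i v i = 0 ->
    \prod_i (y 0 i * expR (v i)) = 1.
  by move=> v0; rewrite big_split /= y1 mul1r -expR_sum v0 expR0.
have posE (v : 'I_n -> R) i : 0 < y 0 i * expR (v i).
  by rewrite mulr_gt0 ?expR_gt0.
have [|c' cc' hc'] := @meval_min_cube_shell R n p (y 0) (capacity p).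
  move=> v [v1 v2 v3]; rewrite lt_neqAle; apply/andP; split; last first.
    by rewrite -[leLHS]mulr1 -(prodE (v 0)) //; apply: capacity_le.
  apply/eqP => ce.
  have : y = \row_i (y 0 i * expR (v 0 i)).
    apply: uy; split; first split=> [i|]; first by rewrite mxE.
      by under eq_bigr do rewrite mxE; rewrite prodE.
    by rewrite [RHS]ce; apply: meval_eq => i; rewrite mxE.
  (* A second minimizer would coincide with y, so v = 0, which has no coordinate equal to 1 or
     -1. *)
  move/rowP => yE; move/eqP: v3; apply/negP.
  apply/prodf_neq0 => i _.
  have -> : v 0 i = 0.
    apply: (@expR_inj R); rewrite expR0; apply: (mulfI (lt0r_neq0 (y0 i))).
    by have := yE i; rewrite mxE mulr1.
  by apply/eqP; rewrite expr0n /=; lra.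
pose d := ln (c' / capacity p).
have c'0 : 0 < c' := lt_trans c0 cc'.
have d0 : 0 < d by rewrite ln_gt0 // ltr_pdivlMr // mul1r.
have dE : capacity p * expR d = c'.
  by rewrite lnK ?posrE ?divr_gt0 // mulrC divfK // gt_eqF.
exists (y 0), d; split=> // u r r1 u0 ur [i0 ui0].
have r0 : 0 < r by lra.
pose v : 'rV[R]_n := \row_i (u i / r).
have shell : cube_shell v.
  split=> [i||].
  - rewrite mxE -ler_norml normrM normfV (gtr0_norm r0) ler_pdivrMr // mul1r.
    exact: ur.
  - by under eq_bigr do rewrite mxE; rewrite -mulr_suml u0 mul0r.
  rewrite (bigD1 i0) //= mxE -[_ ^+ 2]real_normK ?num_real //.
  by rewrite normrM normfV (gtr0_norm r0) ui0 divff ?gt_eqF // expr1n subrr mul0r.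
pose z i := y 0 i * expR (v 0 i).
have pz : c' <= p.@[z] := hc' v shell.
have pz0 : 0 < p.@[z] := lt_le_trans c'0 pz.
have z0 i : 0 <= z i by apply/ltW/posE.
pose A := \sum_i moment p z i * v 0 i.
(* The tangent at z, read back at y, gives p(z) <= cap(p) exp A, so the slope A is at least d. *)
have dA : d <= A.
  have := tangent_le (fun i => - v 0 i) p0 z0 pz0.
  rewrite (@meval_eq _ _ (fun i => z i * expR (- v 0 i)) (y 0) p) => [|i]; last first.
    by rewrite /z /= -mulrA -expRD subrr expR0 mulr1.
  rewrite yc; under eq_bigr do rewrite mulrN.
  rewrite sumrN -/A expRN ler_pdivrMr ?expR_gt0 // => h.
  have := le_trans pz h; rewrite -dE ler_pM2l //.
  by rewrite ler_expR.
have := tangent_le (fun i => (r - 1) * v 0 i) p0 z0 pz0.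
rewrite (@meval_eq _ _ (fun i => z i * expR ((r - 1) * v 0 i))
  (fun i => y 0 i * expR (u i)) p) => [|i]; last first.
  rewrite /z /= -mulrA -expRD mxE; congr (_ * expR _); field.
  exact: lt0r_neq0.
apply: le_trans.
have -> : \sum_i moment p z i * ((r - 1) * v 0 i) = (r - 1) * A.
  by rewrite mulr_sumr; apply: eq_bigr => i _; rewrite mulrCA.
apply: le_trans (ler_wpM2r (expR_ge0 _) pz).
rewrite -dE -mulrA -expRD ler_pM2l // ler_expR; nra.
Qed.

Lemma capacity_coercive p (i j : 'I_n) (M : R) :
    hom_plus n p -> p != 0 -> indecomposable p ->
  exists2 r : R, 0 < r & forall x, (forall k, 0 < x k) -> r * x j <= x i ->
    M * \prod_k x k <= p.@[x].
Proof.
move=> hp pn0 ip; have [hom p0] := hp.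
have [y [d [y0 y1 yc d0 hd]]] := capacity_growth hp pn0 ip.
have c0 : 0 < capacity p by rewrite -yc; apply: meval_gt0.
(* Since exp x >= 1 + x, this T ensures M <= cap(p) exp (d T). *)
pose T := 1 + `|M| / (capacity p * d).
have cd0 : 0 < capacity p * d by rewrite mulr_gt0.
have T1 : 1 <= T by rewrite lerDl divr_ge0 // ltW.
have TM : M <= capacity p * expR (d * T).
  apply: le_trans (ler_norm M) _.
  apply: (@le_trans _ _ (capacity p * (1 + d * T))); last first.
    by rewrite ler_pM2l // expR_ge1Dx.
  have cT : capacity p * d * T = capacity p * d + `|M|.
    by rewrite /T mulrDr mulr1 [_ * (_ / _)]mulrC divfK // gt_eqF.
  by rewrite mulrDr mulr1 mulrA cT; lra.
(* In the coordinates u = log (x / (l y)), this r makes u i - u j >= 2 T, so one of the two has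
   modulus at least T. *)
exists (expR (2 * T) * (y i / y j)).
  by rewrite mulr_gt0 ?expR_gt0 // divr_gt0.
move=> x x0 rx; have [l l0 lE] := exists_root_prod x0.
pose u k := ln (x k / l / y k).
have uE k : expR (u k) = x k / l / y k by rewrite lnK // posrE !divr_gt0.
have u0 : \sum_k u k = 0.
  apply: (@expR_inj R); rewrite expR0 expR_sum; under eq_bigr do rewrite uE.
  rewrite !prodf_div y1 divr1 prodr_const card_ord -lE divff //.
  by rewrite expf_neq0 // gt_eqF.
pose k0 := [arg max_(k > i) `|u k|]%O.
have uk0 k : `|u k| <= `|u k0|.
  by rewrite /k0; case: arg_maxP => //= k' _; apply.
have uij : 2 * T <= u i - u j.
  rewrite -ler_expR expRB !uE.
  have -> : x i / l / y i / (x j / l / y j) = x i / x j * (y j / y i).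
    by field; rewrite !lt0r_neq0.
  have w0 : 0 < y i / y j * x j by rewrite mulr_gt0 // divr_gt0.
  rewrite -(ler_pM2r w0) [leLHS]mulrA; apply: le_trans rx _.
  rewrite le_eqVlt; apply/orP; left; apply/eqP.
  by field; rewrite !lt0r_neq0.
have Tr : T <= `|u k0|.
  have := uk0 i; have := uk0 j; have := ler_norm (u i); have := ler_norm (- u j).
  by rewrite normrN; move: uij; clear; lra.
have := hd u _ (le_trans T1 Tr) u0 uk0 (ex_intro _ k0 erefl).
rewrite -lE (_ : p.@[x] = l ^+ n * p.@[fun k => y k * expR (u k)]); last first.
  rewrite -meval_scale //; apply: meval_eq => k.
  by rewrite uE; field; rewrite !lt0r_neq0.
move=> h; rewrite mulrC ler_wpM2l ?exprn_ge0 ?(ltW l0) //.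
apply: le_trans TM (le_trans _ h).
by rewrite ler_pM2l // ler_expR ler_pM2l.
Qed.

Lemma mcoeff_foldl_mderiv p (s : seq 'I_n) m :
  (foldl (fun q i => q^`M(i)) p s)@_m != 0 ->
  p@_(m + \sum_(i <- s) U_(i))%MM != 0.
Proof.
elim: s p m => [|a s IH] p m /=; first by rewrite big_nil addm0.
move/IH; rewrite mcoeff_mderiv big_cons [(U_(a) + _)%MM]addmC addmA => h.
by apply: contraNneq h => ->; rewrite mul0rn.
Qed.

Lemma gprod_gt0 (D : 'I_n -> nat) d s : 0 < gprod R D d s.
Proof. by elim: s d => [|a s IH] d //=; rewrite mulr_gt0 // greal_gt0. Qed.

(* The monomial x_1 ... x_n x_i / x_j. *)
Definition swap_mnm (i j : 'I_n) : 'X_{1..n} :=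
  [multinom (if k == i then 2 else if k == j then 0 else 1)%N | k < n].

Lemma mdeg_swap_mnm i j : i != j -> mdeg (swap_mnm i j) = n.
Proof.
move=> ij; rewrite mdegE (bigD1 i) //= (bigD1 j) 1?eq_sym //= !mnmE !eqxx.
rewrite eq_sym (negPf ij) add0n.
have := sum1_card 'I_n; rewrite card_ord (bigD1 i) //= (bigD1 j) 1?eq_sym //= addnA.
apply: etrans; congr (_ + _)%N; apply: eq_bigr => k /andP[/negPf ki /negPf kj].
by rewrite mnmE ki kj.
Qed.

(* If the coefficient vanished, eliminating all variables but i and j would
   leave a form that is O(t) at x_i = 1, x_j = t, against [capacity_coercive]. *)
Lemma mcoeff_swap_neq0 p (i j : 'I_n) : hom_plus n p -> p != 0 -> stable p ->
  indecomposable p -> i != j -> p@_(swap_mnm i j) != 0.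
Proof.
move=> hp pn0 sp ip ij; have [hom p0] := hp; have /dhomogP hm := hom; apply/eqP => pe.
pose s := [seq k <- enum 'I_n | (k != i) && (k != j)].
have us : uniq s by rewrite filter_uniq // enum_uniq.
have sE k : (k \in s) = (k != i) && (k != j) by rewrite mem_filter mem_enum andbT.
pose q := foldl (fun q k => q^`M(k)) p s.
have q0 : nnegc q.
  rewrite /q; elim: (s) (p) p0 => [|a r IH] p' p'0 //=.
  by apply: IH; apply: nnegc_mderiv.
pose B := \sum_(m <- msupp q) q@_m.
pose g := gprod R (fun=> n) n s.
have g0 : 0 < g by apply: gprod_gt0.
have B0 : 0 <= B by rewrite sumr_ge0.
(* With this constant, elimination yields q >= (B + 1) t at x_i = 1, x_j = t, to be contradicted by
   q <= B t. *)
have [r r0 hr] := capacity_coercive i j ((B + 1) / g) hp pn0 ip.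
pose t := Num.min 1 r^-1.
have t0 : 0 < t by rewrite lt_min ltr01 invr_gt0.
have t1 : t <= 1 by rewrite ge_min lexx.
have rt : r * t <= 1 by rewrite -ler_pdivlMl // mulr1 ge_min lexx orbT.
pose x k : R := if k == i then 1 else t.
have x0 k : 0 <= x k by rewrite /x; case: ifP => // _; apply: ltW.
have bd : degree_bound p (fun=> n).
  move=> m k mp; have md : mdeg m = n by apply: hm.
  by apply: leq_trans (eq_leq md); rewrite mdegE (bigD1 k) //= leq_addr.
have lower y : (forall k, k \in s -> 0 < y k) -> (forall k, k \notin s -> y k = x k) ->
    (B + 1) / g * t * \prod_(k <- s) y k <= p.@[y].
  move=> ys yx.
  have yi : y i = 1 by rewrite yx ?sE ?eqxx // /x eqxx.
  have yj : y j = t.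
    by rewrite yx ?sE ?eqxx ?andbF // /x eq_sym (negPf ij).
  have y0 k : 0 < y k.
    have [/ys //|ks] := boolP (k \in s).
    by rewrite yx // /x; case: ifP.
  have := hr y y0; rewrite yi yj => /(_ rt); apply: le_trans.
  rewrite -mulrA ler_wpM2l ?divr_ge0 ?addr_ge0 ?(ltW g0) //.
  rewrite (bigD1 i) //= (bigD1 j) 1?eq_sym //= yi yj mul1r ler_wpM2l ?(ltW t0) //.
  by rewrite big_filter big_enum_cond.
have := gprod_foldl_mderiv us hom p0 sp bd x0 lower.
apply/negP; rewrite -ltNge -/g -/q.
apply: (@le_lt_trans _ _ (t * B)); last first.
  by rewrite mulrA [g * _]mulrC divfK ?gt_eqF // mulrC ltr_pM2r // ltrDl.
pose w k : R := if k \in s then 0 else x k.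
rewrite -[_.@[_]]/(q.@[w]) mevalE mulr_sumr big_seq [leRHS]big_seq; apply: ler_sum => m mq.
rewrite [leRHS]mulrC ler_wpM2l //.
have w1 k : 0 <= w k <= 1.
  rewrite /w; case: ifP => _; first by rewrite lexx ler01.
  by rewrite x0 /x; case: ifP => _; rewrite ?lexx ?t1.
have wle k : w k ^+ m k <= 1.
  by rewrite exprn_ile1 //; case/andP: (w1 k).
have w0 k : 0 <= w k ^+ m k by rewrite exprn_ge0 //; case/andP: (w1 k).
have prod_le (P : pred 'I_n) : \prod_(k | P k) w k ^+ m k <= 1.
  by apply: prodr_ile1 => k _; rewrite w0 wle.
(* A monomial of q containing x_j gives a factor t, one containing an eliminated variable gives 0,
   and any other comes from the excluded monomial of p. *)
have [mj|mj] := posnP (m j); last first.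
  rewrite (bigD1 j) //=.
  have wj : w j = t by rewrite /w sE eqxx andbF /x eq_sym (negPf ij).
  apply: (@le_trans _ _ (t * 1)); last by rewrite mulr1.
  rewrite ler_pM //; first by rewrite prodr_ge0.
  by rewrite wj -(prednK mj) exprS ler_piMr ?(ltW t0) // exprn_ile1 // ltW.
have [/hasP[k ks mk]|] := boolP (has (fun k => 0 < m k)%N s).
  rewrite (bigD1 k) //= /w ks expr0n eqn0Ngt mk mul0r; exact: ltW.
rewrite -all_predC => /allP ms.
exfalso; move: mq; rewrite mcoeff_msupp => /mcoeff_foldl_mderiv.
set m' := (m + _)%MM => pm'.
suff m'E : m' = swap_mnm i j by rewrite m'E pe eqxx in pm'.
have m'k k : k != i -> m' k = swap_mnm i j k.
  move=> ki; rewrite mnmDE mnm_sumE mnmE (negPf ki).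
  under eq_bigr do rewrite mnm1E.
  have -> : (\sum_(l <- s) (l == k))%N = (k \in s).
    rewrite -big_mkcond /= sum1_count; exact: count_uniq_mem.
  rewrite sE ki /=; case: eqP => [->|/eqP kj]; first by rewrite mj.
  have := ms k; rewrite sE ki kj => /(_ isT) /=; rewrite -leqNgt leqn0 => /eqP ->.
  by [].
apply/mnmP => k; have [->|/m'k //] := eqVneq k i.
have m'n : mdeg m' = n by apply: hm; rewrite mcoeff_msupp.
have := esym (etrans m'n (esym (mdeg_swap_mnm ij))).
rewrite !mdegE (bigD1 i) //= [in RHS](bigD1 i) //= (eq_bigr m' (fun k h => esym (m'k k h))).
by move/addIn.
Qed.

End Capacity.

(** * The mixed derivative as a coefficient and as an iterated derivative *)

Section MixedDerivative.

Lemma meval_fun0 n (S : comNzRingType) (p : {mpoly S[n]}) :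
  p.@[fun=> 0] = p@_0.
Proof.
rewrite mevalE; have prod0 (m : 'X_{1..n}) : m != 0%MM ->
    \prod_i (0 : S) ^+ m i = 0.
  move=> m0; have [i mi] : exists i, m i != 0%N.
    apply/existsP; apply: contraNT m0; rewrite negb_exists => /forallP h.
    by apply/eqP/mnmP => i; rewrite mnm0E; apply/eqP; rewrite -[_ == _]negbK h.
  by rewrite (bigD1 i) //= expr0n (negPf mi) mul0r.
have [p0|p0] := boolP (0%MM \in msupp p).
  rewrite (bigD1_seq _ p0 (msupp_uniq p)) /= [X in _ + X]big1 => [|m m0].
    by rewrite addr0 big1 ?mulr1 // => i _; rewrite mnm0E expr0.
  by rewrite prod0 ?mulr0.
rewrite memN_msupp_eq0 // big_seq big1 // => m mp.
by rewrite prod0 ?mulr0 //; apply: contraNneq p0 => <-.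
Qed.

Lemma mixed_derivativeE n (S : comNzRingType) (p : {mpoly S[n]}) :
  mixed_derivative p = p@_[multinom 1%N | i < n].
Proof.
rewrite /mixed_derivative meval_fun0 mcoeff_mderivm addm0 big1 ?mulr1n // => i _.
by rewrite mnmE.
Qed.

Lemma mixed_derivative_foldl n (S : comNzRingType) (p : {mpoly S[n]}) :
  mixed_derivative p = (foldl (fun q i => q^`M(i)) p (enum 'I_n)).@[fun=> 0].
Proof.
rewrite /mixed_derivative /mderivm.
have -> : foldl (fun q i => q^`M(i)) p (enum 'I_n) = foldr (@mderiv _ _) p (enum 'I_n).
  by rewrite -[X in foldl _ _ X]revK foldl_rev; apply: mderiv_perm; rewrite perm_rev.
by congr meval; elim: (enum _) => //= i s ->; rewrite mnmE.
Qed.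

End MixedDerivative.

(** * Comparison of the capacity with the mixed derivative and with values of p *)

Section Bounds.
Context (R : realType) (n : nat).

(** Inverted, this says that (1 + 1/k)^k increases, which is AM-GM for k copies of 1/k padded with
    one zero. *)
Lemma greal_anti k k' : (k <= k')%N -> greal R k' <= greal R k.
Proof.
move=> kk'; elim: k' kk' => [|k' IH]; first by rewrite leqn0 => /eqP ->.
rewrite leq_eqVlt ltnS => /predU1P[-> //|/IH]; apply: le_trans => {k IH}.
case: k' => [|[|k]]; first by rewrite /greal !expr0.
  by rewrite {2}/greal expr0 greal_le1.
have k1 : 0 < k.+1%:R :> R by rewrite ltr0n.
have k2 : 0 < k.+2%:R :> R by rewrite ltr0n.
have k3 : 0 < k.+3%:R :> R by rewrite ltr0n.
rewrite /greal /= -[k.+2%:R / _]invf_div -[k.+1%:R / _]invf_div !exprVn.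
rewrite lef_pV2 ?posrE ?exprn_gt0 ?divr_gt0 //.
have := @prod_le_AGM R (nseq k.+1 k.+1%:R^-1) k.+1 1.
rewrite size_nseq leqnSn ler01 all_nseq invr_ge0 ler0n orbT.
move=> /(_ isT isT isT).
rewrite !big_nseq iter_mulr_1 iter_addr_0 -[_^-1 *+ _]mulr_natr mulVf ?gt_eqF // !mul1r.
have D (a b : R) : 0 < a -> b = a + 1 -> 1 + a^-1 = b / a.
  by move=> a0 ->; rewrite mulrDl mul1r divff // gt_eqF.
by rewrite (D _ k.+2%:R k1) ?natr1 // (D _ k.+3%:R k2) ?natr1.
Qed.

(** By induction: k! / k^k times g(k + 1) is (k + 1)! / (k + 1)^(k + 1). This is the source of the
    constant n^n / n!. *)
Lemma prod_greal_rev k : \prod_(i < k) greal R (k - i) = k`!%:R / k%:R ^+ k.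
Proof.
have -> : \prod_(i < k) greal R (k - i) = \prod_(i < k) greal R i.+1.
  rewrite (reindex_inj rev_ord_inj) /=; apply: eq_bigr => i _.
  by rewrite subKn.
elim: k => [|k IH]; first by rewrite big_ord0 fact0 expr0 divr1.
rewrite big_ord_recr IH /greal /= factS natrM exprS invfM mulrACA.
rewrite divff ?pnatr_eq0 // mul1r expr_div_n.
case: k {IH} => [|k]; first by rewrite !expr0 !divr1 mulr1.
by rewrite mulrA divfK // expf_neq0 // pnatr_eq0.
Qed.

(** After i eliminations the remaining degree is n - i; ordinals start at 0, so this is n + 1 - i
    for variables numbered from 1. *)
Lemma gprod_enum (D : 'I_n -> nat) :
  gprod R D n (enum 'I_n) = \prod_(i < n) greal R (minn (D i) (n - i)).
Proof.
have E i0 d s : gprod R D d s =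
    \prod_(0 <= k < size s) greal R (minn (D (nth i0 s k)) (d - k)).
  elim: s d => [|a s IH] d; first by rewrite big_nil.
  rewrite /= big_nat_recl // subn0 IH; congr (_ * _).
  by apply: eq_bigr => k _; rewrite -subn1 -subnDA add1n.
case: (posnP n) => [n0|n0].
  rewrite [RHS]big1 => [|i _]; last by case: i => i li; exfalso; move: (li); rewrite n0.
  have : size (enum 'I_n) = 0%N by rewrite size_enum_ord.
  by case: (enum _).
rewrite (E (Ordinal n0)) size_enum_ord big_mkord; apply: eq_bigr => i _.
by rewrite nth_ord_enum.
Qed.

Lemma ratr_gfun k : ratr (gfun k) = greal R k.
Proof. by rewrite /gfun /greal rmorphXn /= fmorph_div /= !ratr_nat. Qed.

Lemma capacity_le_mixed_derivative (p : {mpoly R[n]}) (D : 'I_n -> nat) :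
    hom_plus n p -> stable p -> degree_bound p D ->
  (\prod_(i < n) greal R (minn (D i) (n - i))) * capacity p <= mixed_derivative p.
Proof.
move=> hp sp bd; have [hom p0] := hp.
rewrite -gprod_enum mixed_derivative_foldl.
rewrite (@meval_eq _ _ (fun=> 0) (fun i => if i \in enum 'I_n then 0 else 0)) => [|i]; last first.
  by rewrite if_same.
apply: gprod_foldl_mderiv => //; first exact: enum_uniq.
move=> y y0 _; rewrite (_ : \prod_(i <- enum 'I_n) y i = \prod_i y i); last first.
  by rewrite big_enum.
by apply: capacity_le => // i; apply: y0; rewrite mem_enum.
Qed.

Lemma le_mixed_derivative (p : {mpoly R[n]}) (x : 'I_n -> R) :
  nnegc p -> (forall i, 0 <= x i) -> mixed_derivative p * \prod_i x i <= p.@[x].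
Proof.
move=> p0 x0; have := le_mcoeff_meval [multinom 1%N | i < n] p0 x0.
by rewrite mixed_derivativeE; under eq_bigr do rewrite mnmE.
Qed.

Lemma intr_ge1 (z : int) : 0 <= z%:~R :> R -> z%:~R != 0 :> R -> 1 <= z%:~R :> R.
Proof.
move=> z0 zn0; rewrite ler1z; rewrite ler0z in z0; rewrite intr_eq0 in zn0.
by rewrite -gtz0_ge1 lt_def zn0.
Qed.

Lemma capacity_gt0 (p : {mpoly R[n]}) :
  hom_plus n p -> p != 0 -> indecomposable p -> 0 < capacity p.
Proof.
by move=> [_ p0] pn0 [y [[[y0 _] <-] _]]; apply: meval_gt0.
Qed.

(** For i <> j a single monomial suffices, that of [swap_mnm i j], whose nonzero integer coefficient
    is at least 1. For i = j it is x_1 ... x_n, with coefficient positive by Gurvits' inequality. *)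
Lemma ratio_le_meval (p : {mpoly int[n]}) (x : 'I_n -> R) i j :
    let pR : {mpoly R[n]} := map_mpoly intr p in
    hom_plus n pR -> pR != 0 -> stable pR -> indecomposable pR ->
    (forall k, 0 < x k) ->
  x i * \prod_k x k <= x j * pR.@[x].
Proof.
move=> pR hp pn0 sp ip x0; have [hom p0] := hp.
have coef1 m : pR@_m != 0 -> 1 <= pR@_m.
  by rewrite /pR mcoeff_map_mpoly; apply: intr_ge1; rewrite -mcoeff_map_mpoly.
have x0' k : 0 <= x k by apply: ltW.
have [->|ij] := eqVneq i j.
  rewrite ler_pM2l // -[leLHS]mul1r; apply: le_trans (le_mixed_derivative p0 x0').
  rewrite ler_wpM2r ?prodr_ge0 // mixed_derivativeE coef1 // -mixed_derivativeE.
  have bd : degree_bound pR (fun=> n).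
    move=> m k mp; have md : mdeg m = n by move/dhomogP: hom; apply.
    by apply: leq_trans (eq_leq md); rewrite mdegE (bigD1 k) //= leq_addr.
  rewrite gt_eqF //; apply: lt_le_trans (capacity_le_mixed_derivative hp sp bd).
  rewrite mulr_gt0 ?capacity_gt0 // prodr_gt0 // => k _; exact: greal_gt0.
apply: (@le_trans _ _ (x j * \prod_k x k ^+ swap_mnm i j k)).
  pose W := \prod_(k | (k != i) && (k != j)) x k.
  have -> : \prod_k x k = x i * (x j * W).
    by rewrite (bigD1 i) //= (bigD1 j) 1?eq_sym.
  have -> : \prod_k x k ^+ swap_mnm i j k = x i ^+ 2 * W.
    rewrite (bigD1 i) //= (bigD1 j) 1?eq_sym //= !mnmE !eqxx eq_sym (negPf ij).
    rewrite expr0 mul1r; congr (_ * _); apply: eq_bigr => k /andP[/negPf ki /negPf kj].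
    by rewrite mnmE ki kj.
  by rewrite le_eqVlt; apply/orP; left; apply/eqP; ring.
rewrite ler_pM2l // -[leLHS]mul1r; apply: le_trans (le_mcoeff_meval (swap_mnm i j) p0 x0').
rewrite ler_wpM2r ?prodr_ge0 // => [k _|]; first by rewrite exprn_ge0.
by rewrite coef1 // mcoeff_swap_neq0.
Qed.

(** Both x and the minimizer y have coordinate ratios at most 2^K, so the entries of u = log (y / x)
    differ by at most 2 K log 2. The tangent at x towards y then loses at most 2 n K d log 2 <= log
    2, a factor 2. *)
Lemma meval_le_2capacity (p : {mpoly int[n]}) (x : 'I_n -> R) (K : nat) (d : R) :
    let pR : {mpoly R[n]} := map_mpoly intr p in
    hom_plus n pR -> pR != 0 -> stable pR -> indecomposable pR ->
    (forall i, 0 < x i) -> pR.@[fun=> 1] <= 2 ^+ K ->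
    pR.@[x] <= pR.@[fun=> 1] * \prod_i x i ->
    (forall i, 1 - d <= moment pR x i) -> 0 <= d -> 2 * n%:R * K%:R * d <= 1 ->
  pR.@[x] <= 2 * capacity pR * \prod_i x i.
Proof.
move=> pR hp pn0 sp ip x0 p1K px hd d0 nKd; have [hom p0] := hp.
have [y [[[y0 y1] yc] uy]] := ip.
have Px0 : 0 < \prod_i x i by apply: prodr_gt0.
have px0 : 0 < pR.@[x] by apply: meval_gt0.
have p1 : 0 < pR.@[fun=> 1] by apply: meval_gt0.
have [n0|[i0]] : (n = 0)%N \/ exists i : 'I_n, true.
- by case: (posnP n) => [|n0]; [left|right; exists (Ordinal n0)].
- have -> : pR.@[x] = capacity pR.
    by rewrite -yc; apply: meval_eq => -[i li]; exfalso; move: (li); rewrite n0.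
  rewrite big1 => [|i _]; last by case: i => i li; exfalso; move: (li); rewrite n0.
  by rewrite mulr1; have := capacity_gt0 hp pn0 ip; lra.
move=> _.
have ratio (z : 'I_n -> R) i j : (forall k, 0 < z k) ->
    pR.@[z] <= pR.@[fun=> 1] * \prod_k z k -> z i <= 2 ^+ K * z j.
  move=> z0 pz; have Pz0 : 0 < \prod_k z k by apply: prodr_gt0.
  rewrite -(ler_pM2r Pz0); apply: le_trans (ratio_le_meval i j hp pn0 sp ip z0) _.
  rewrite mulrAC mulrC ler_wpM2r ?(ltW (z0 _)) //; apply: le_trans pz _.
  by rewrite ler_wpM2r // ltW.
have py1 : pR.@[y 0] <= pR.@[fun=> 1] * \prod_k y 0 k.
  rewrite y1 mulr1 yc -[leLHS]mulr1.
  by have := @capacity_le _ _ pR (fun=> 1) hp; rewrite big1 //; apply.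
pose u i := ln (y 0 i / x i).
have uE i : expR (u i) = y 0 i / x i by rewrite lnK // posrE divr_gt0.
pose l := ln (2 : R).
have lE : expR l = 2 by rewrite lnK // posrE.
have l0 : 0 < l by rewrite ln_gt0 //; lra.
(* As the moments sum to n, subtracting the smallest entry of u changes nothing in the sum of
   (moment - 1) u, and it leaves nonnegative factors, so lower bounds on the moments suffice. *)
pose j := [arg min_(k < i0) u k]%O.
have uj k : u j <= u k.
  by rewrite /j; case: arg_minP => //= k' _; apply.
have uK k : u k - u j <= 2 * K%:R * l.
  have -> : u k - u j = ln ((y 0 k / y 0 j) * (x j / x k)).
    rewrite /u !ln_div ?posrE ?divr_gt0 // lnM ?posrE ?divr_gt0 // !ln_div ?posrE //.
    by ring.
  rewrite -ler_expR lnK ?posrE ?mulr_gt0 ?invr_gt0 //.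
  have -> : expR (2 * K%:R * l) = 2 ^+ K * 2 ^+ K.
    have -> : 2 ^+ K = expR (K%:R * l) by rewrite expRM_natl lE.
    by rewrite -expRD; congr expR; ring.
  apply: ler_pM; rewrite ?divr_ge0 ?(ltW (y0 _)) ?(ltW (x0 _)) //.
    by rewrite ler_pdivrMr //; apply: ratio.
  by rewrite ler_pdivrMr //; apply: ratio.
have x0' k : 0 <= x k by apply: ltW.
have := tangent_le u p0 x0' px0.
rewrite (@meval_eq _ _ (fun i => x i * expR (u i)) (y 0)) => [|k]; last first.
  by rewrite uE mulrC divfK // gt_eqF.
rewrite yc => tl.
have su : expR (\sum_k u k) = (\prod_k x k)^-1.
  by rewrite expR_sum; under eq_bigr do rewrite uE; rewrite prodf_div y1 mul1r.
have sm : \sum_k (moment pR x k - 1) = 0.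
  by rewrite sumrB (sum_moment hom px0) sumr_const card_ord subrr.
have : \sum_k u k - l <= \sum_k moment pR x k * u k.
  have -> : \sum_k moment pR x k * u k =
      \sum_k (moment pR x k - 1) * (u k - u j) + \sum_k u k.
    transitivity (\sum_k ((moment pR x k - 1) * (u k - u j) + u k
        + (moment pR x k - 1) * u j)); first by apply: eq_bigr => k _; ring.
    by rewrite !big_split /= -[X in _ + X]mulr_suml sm mul0r addr0.
  rewrite addrC lerD2r.
  have -> : - l = \sum_(k < n) (- (l / n%:R)).
    rewrite sumr_const card_ord -[RHS]mulr_natr mulNr divfK //.
    by rewrite pnatr_eq0 -lt0n; case: (i0) => m; apply: leq_ltn_trans.
  apply: ler_sum => k _.
  have n0' : 0 < n%:R :> R by rewrite ltr0n; case: (i0) => m; apply: leq_ltn_trans.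
  have v0 : 0 <= u k - u j by rewrite subr_ge0.
  apply: (@le_trans _ _ (- (d * (2 * K%:R * l)))).
    rewrite lerN2 ler_pdivlMr //.
    have := ler_wpM2r (ltW l0) nKd; rewrite mul1r; apply: le_trans.
    by rewrite le_eqVlt; apply/orP; left; apply/eqP; ring.
  have h1 := ler_wpM2l d0 (uK k).
  have : 0 <= (moment pR x k - 1 + d) * (u k - u j).
    by rewrite mulr_ge0 //; have := hd k; lra.
  by move: h1; clear; lra.
move=> sl.
have : (\prod_k x k)^-1 / 2 <= expR (\sum_k moment pR x k * u k).
  by rewrite -su -[X in _ / X]lE -expRB ler_expR.
move=> h.
have := le_trans (ler_wpM2l (ltW px0) h) tl.
rewrite mulrA ler_pdivrMr // ler_pdivrMr //.
by rewrite [2 * _]mulrC.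
Qed.

End Bounds.

(** * The program *)

Arguments upd : simpl never.

Lemma upd_same (T : Type) (f : nat -> T) a v : upd f a v a = v.
Proof. by rewrite /upd eqxx. Qed.

Lemma upd_neq (T : Type) (f : nat -> T) a v b : b != a -> upd f a v b = f b.
Proof. by rewrite /upd => /negPf ->. Qed.

Local Ltac updsimp :=
  repeat (first [rewrite upd_same | rewrite upd_neq; [|by lia]]).

(** * A cost calculus for programs *)

Section Costs.
Context (n : nat) (f : 'rV[rat]_n -> rat) (Good : 'rV[rat]_n -> Prop).
Implicit Types (c : cmd) (s : state) (T Q : nat) (P : state -> Prop).

(** A total-correctness triple with budgets for operations and queries; [Good] will carry the bit
    size bound. *)
Definition runs c s T Q P := exists t qs s',
  [/\ exec f c s t qs s', (t <= T)%N, (size qs <= Q)%N,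
      forall x, x \in qs -> Good x & P s'].

Lemma runs_weaken c s T Q P T' Q' P' : runs c s T' Q' P' ->
  (T' <= T)%N -> (Q' <= Q)%N -> (forall s', P' s' -> P s') -> runs c s T Q P.
Proof.
move=> [t [qs [s' [e tT qQ g p']]]] TT QQ PP; exists t, qs, s'; split=> //.
- exact: leq_trans TT.
- exact: leq_trans QQ.
- exact: PP.
Qed.

Lemma runs_le c s T Q P T' Q' :
  runs c s T' Q' P -> (T' <= T)%N -> (Q' <= Q)%N -> runs c s T Q P.
Proof. by move=> h hT hQ; apply: (runs_weaken h hT hQ). Qed.

Lemma runs_seq c1 c2 s T1 T2 Q1 Q2 P1 P :
  runs c1 s T1 Q1 P1 -> (forall s1, P1 s1 -> runs c2 s1 T2 Q2 P) ->
  runs (Seq c1 c2) s (T1 + T2) (Q1 + Q2) P.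
Proof.
move=> [t1 [qs1 [s1 [e1 tT1 qQ1 g1 p1]]]] /(_ _ p1).
move=> [t2 [qs2 [s2 [e2 tT2 qQ2 g2 p2]]]].
exists (t1 + t2)%N, (qs1 ++ qs2), s2; split=> //.
- exact: ExecSeq e1 e2.
- exact: leq_add.
- by rewrite size_cat leq_add.
- by move=> x; rewrite mem_cat => /orP[/g1|/g2].
Qed.

Lemma runs_setreg a e s P :
  P (State (upd (regs s) a (ieval s e)) (cells s)) ->
  runs (SetReg a e) s (isize e).+1 0 P.
Proof. by move=> p; do 3 eexists; split; [exact: ExecSetReg|..]. Qed.

Lemma runs_setcell i e s P :
  P (State (regs s) (upd (cells s) (ieval s i) (qeval s e))) ->
  runs (SetCell i e) s (isize i + qsize e).+1 0 P.
Proof. by move=> p; do 3 eexists; split; [exact: ExecSetCell|..]. Qed.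

Lemma runs_query i j s P :
  let x := \row_(k < n) cells s (ieval s i + k)%N in
  Good x -> P (State (regs s) (upd (cells s) (ieval s j) (f x))) ->
  runs (Query i j) s (isize i + isize j).+1 1 P.
Proof.
move=> x g p; do 3 eexists; split; [exact: ExecQuery|by []|by []| |exact: p].
by move=> y; rewrite inE => /eqP ->.
Qed.

Lemma runs_setreg_seq a e c s T Q P :
  runs c (State (upd (regs s) a (ieval s e)) (cells s)) T Q P ->
  runs (Seq (SetReg a e) c) s ((isize e).+1 + T) Q P.
Proof. by move=> h; apply: runs_seq (runs_setreg (P := eq _) _) _ => // _ <-. Qed.

Lemma runs_setcell_seq i e c s T Q P :
  runs c (State (regs s) (upd (cells s) (ieval s i) (qeval s e))) T Q P ->
  runs (Seq (SetCell i e) c) s ((isize i + qsize e).+1 + T) Q P.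
Proof. by move=> h; apply: runs_seq (runs_setcell (P := eq _) _) _ => // _ <-. Qed.

Lemma runs_query_seq i j c s T Q P :
  let x := \row_(k < n) cells s (ieval s i + k)%N in
  Good x ->
  runs c (State (regs s) (upd (cells s) (ieval s j) (f x))) T Q P ->
  runs (Seq (Query i j) c) s ((isize i + isize j).+1 + T) Q.+1 P.
Proof.
by move=> x g h; apply: runs_seq (runs_query (P := eq _) g _) _ => // _ <-.
Qed.

Lemma runs_if b c1 c2 s T Q P :
  runs (if teval s b then c1 else c2) s T Q P ->
  runs (If b c1 c2) s (bsize b + T) Q P.
Proof.
move=> [t [qs [s' [e tT qQ g p]]]]; exists (bsize b + t)%N, qs, s'; split=> //.
- exact: ExecIf.
- by rewrite leq_add2l.
Qed.

(* The index of the invariant bounds the number of remaining iterations. *)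
Lemma runs_while b c (Inv : nat -> state -> Prop) T Q :
    (forall k s, Inv k s -> teval s b ->
      runs c s T Q (fun s' => exists2 k', (k' < k)%N & Inv k' s')) ->
  forall k s, Inv k s ->
  runs (While b c) s (bsize b + k * (bsize b + T)) (k * Q)
    (fun s' => ~~ teval s' b /\ exists k', Inv k' s').
Proof.
move=> body; elim/ltn_ind => k IH s inv.
have [tb|ntb] := boolP (teval s b); last first.
  exists (bsize b), [::], s; split=> //; last by split=> //; exists k.
    exact: ExecWhileStop.
  exact: leq_addr.
have [t1 [qs1 [s1 [e1 tT1 qQ1 g1 [k' k'k inv']]]]] := body _ _ inv tb.
have [t2 [qs2 [s2 [e2 tT2 qQ2 g2 p2]]]] := IH _ k'k _ inv'.
exists (bsize b + t1 + t2)%N, (qs1 ++ qs2), s2; split=> //.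
- exact: ExecWhileStep e1 e2.
- have := leq_mul k'k (leqnn (bsize b + T)%N); rewrite mulSn; lia.
- by rewrite size_cat; have := leq_mul k'k (leqnn Q); rewrite mulSn; lia.
- by move=> x; rewrite mem_cat => /orP[/g1|/g2].
Qed.

End Costs.

(** * The search program and the invariants of its loops *)

Section Program.

Let c (k : nat) : qexp := QCell (IConst k).
Let xcell : iexp := IAdd (IConst 6) (IReg 1).
Let incr_reg : cmd := SetReg 1 (IAdd (IReg 1) (IConst 1)).

(** Rational expressions cannot take a register as a value, so n is counted into cell 5 while x is
    filled with ones. *)
Definition init_loop : cmd :=
  While (ILt (IReg 1) (IReg 0))
    (Seq (SetCell xcell (QConst 1))
      (Seq (SetCell (IConst 5) (QAdd (c 5) (QConst 1))) incr_reg)).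

Definition log_loop : cmd :=
  While (QLt (c 3) (c 1))
    (Seq (SetCell (IConst 3) (QMul (c 3) (QConst 2)))
         (SetCell (IConst 4) (QAdd (c 4) (QConst 1)))).

(** A trial multiplies x_1 ... x_n by q, so a value below (1 - s^2) q p(x) means that p(x) / (x_1
    ... x_n) has dropped by more than the factor 1 - s^2. *)
Let threshold : qexp :=
  QMul (QMul (QSub (QConst 1) (QMul (QSub (c 3) (QConst 1)) (QSub (c 3) (QConst 1))))
    (c 3)) (c 1).

(** A success restarts at coordinate 0 and a failure undoes the trial, so the loop ends only when
    every coordinate has failed at the same x. *)
Definition search_loop : cmd :=
  While (ILt (IReg 1) (IReg 0))
    (Seq (SetCell xcell (QMul (QCell xcell) (c 3)))
      (Seq (Query (IConst 6) (IConst 4))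
        (If (QLt (c 4) threshold)
          (Seq (SetCell (IConst 1) (c 4))
            (Seq (SetCell (IConst 2) (QMul (c 2) (c 3))) (SetReg 1 (IConst 0))))
          (Seq (SetCell xcell (QDiv (QCell xcell) (c 3))) incr_reg)))).

(* Memory: register 0 holds n and register 1 a coordinate i; cell 1 holds p(x),
   cell 2 the product of the x_i, cell 3 first 2^K and then the ratio
   1 + 1/(8 n^3 K) of the search grid, cell 4 first K and then p at the trial
   point, cell 5 holds n, and cells 6, 7, ... hold x. *)
Definition capacity_program : cmd :=
  Seq init_loop
 (Seq (Query (IConst 6) (IConst 1))
 (Seq (SetCell (IConst 3) (QConst 2))
 (Seq (SetCell (IConst 4) (QConst 1))
 (Seq log_loop
 (Seq (SetCell (IConst 3) (QAdd (QConst 1) (QDiv (QConst 1)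
        (QMul (QMul (QMul (QMul (QConst 8) (c 5)) (c 5)) (c 5)) (c 4)))))
 (Seq (SetCell (IConst 2) (QConst 1))
 (Seq (SetReg 1 (IConst 0))
 (Seq search_loop
      (SetCell (IConst 0) (QDiv (c 1) (c 2))))))))))).

Context (n : nat) (f : 'rV[rat]_n -> rat) (Good : 'rV[rat]_n -> Prop).

Lemma init_loop_runs s : regs s 0%N = n -> regs s 1%N = 0%N -> cells s 5%N = 0 ->
  runs f Good init_loop s (3 + n * 22) 0
    (fun s' => [/\ regs s' 0%N = n, cells s' 5%N = n%:R &
      forall j, (j < n)%N -> cells s' (6 + j)%N = 1]).
Proof.
move=> r0 r1 c5.
pose Inv k s := [/\ regs s 0%N = n, (regs s 1%N + k)%N = n,
  cells s 5%N = (regs s 1%N)%:R &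
  forall j, (j < regs s 1%N)%N -> cells s (6 + j)%N = 1].
have inv0 : Inv n s by split; rewrite ?r1 // c5.
apply: runs_weaken (runs_while (Inv := Inv) (T := 19) (Q := 0) _ inv0) _ _ _.
- move=> k s1 [i0 i1 i5 ix] /=; rewrite i0 => lt_n.
  eapply (runs_weaken (P' := Inv k.-1)).
  - eapply runs_setcell_seq, runs_setcell_seq, runs_setreg; split=> //=.
    + rewrite upd_same; lia.
    + by rewrite !upd_same upd_neq ?i5 ?natrD //; lia.
    move=> j; rewrite upd_same upd_neq; last by lia.
    have [->|ne] := eqVneq j (regs s1 1%N); first by rewrite upd_same.
    move=> lt_j; rewrite upd_neq ?ix //; lia.
  - by [].
  - by [].
  - by move=> s' inv; exists k.-1 => //; lia.
- by rewrite /=; lia.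
- by rewrite muln0.
move=> s' [/= nb [k [i0 i1 i5 ix]]]; rewrite i0 -leqNgt in nb.
have r1n : regs s' 1%N = n by lia.
by rewrite r1n in i5 ix.
Qed.

(** Counting starts at exponent 1, so the final exponent [K.+1] can be divided by even when p(1,
    ..., 1) = 1. *)
Lemma log_loop_runs s K : regs s 0%N = n ->
    (forall j, (j < K)%N -> 2 ^+ j.+1 < cells s 1%N) -> cells s 1%N <= 2 ^+ K.+1 ->
    cells s 3%N = 2 -> cells s 4%N = 1 ->
  runs f Good log_loop s (5 + K * 30) 0
    (fun s' => [/\ regs s' = regs s, cells s' 4%N = K.+1%:R &
      forall a, a != 3%N -> a != 4%N -> cells s' a = cells s a]).
Proof.
move=> r0 hK vK c3 c4.
pose Inv k s' := [/\ regs s' = regs s, (k <= K)%N, cells s' 3%N = 2 ^+ (K - k).+1,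
  cells s' 4%N = (K - k).+1%:R
  & forall a, a != 3%N -> a != 4%N -> cells s' a = cells s a].
have inv0 : Inv K s by split; rewrite ?subnn ?expr1.
apply: runs_weaken (runs_while (Inv := Inv) (T := 25) (Q := 0) _ inv0) _ _ _.
- move=> k s1 [i0 kK i3 i4 ia] /=; rewrite i3 ia // => lt_v.
  have k0 : (0 < k)%N.
    rewrite lt0n; apply/negP => /eqP k0; move: lt_v; rewrite k0 subn0.
    by rewrite ltNge vK.
  have Kk : (K - k.-1 = (K - k).+1)%N by lia.
  eapply (runs_weaken (P' := Inv k.-1)).
  - eapply runs_setcell_seq, runs_setcell; split=> //=.
    + by lia.
    + by rewrite upd_neq // upd_same i3 Kk [in RHS]exprS mulrC.
    + by rewrite upd_same upd_neq // i4 Kk -[in RHS]natr1.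
    + by move=> a a3 a4; rewrite !upd_neq // ia.
  - by [].
  - by [].
  - by move=> s' inv; exists k.-1 => //; lia.
- by rewrite /=; lia.
- by rewrite muln0.
move=> s' [/= nb [k [i0 kK i3 i4 ia]]]; split=> //.
case: (posnP k) => k0; first by rewrite k0 subn0 in i4.
move: nb; rewrite i3 ia // hK //; lia.
Qed.

Context (q : rat) (tmax : nat).

Definition grid (e : nat -> nat) : 'rV[rat]_n := \row_(j < n) q ^+ e j.

Definition weight (e : nat -> nat) : nat := \sum_(j < n) e j.

Definition bump_at (e : nat -> nat) (i j : nat) : nat := (e j + (j == i))%N.

Let thr : rat := (1 - (q - 1) * (q - 1)) * q.

(** The invariant of the search: [weight e] counts the successful steps, each gaining the threshold
    factor. It will bound [weight e] and so yield termination. *)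
Definition reachable (v0 : rat) (e : nat -> nat) :=
  f (grid e) <= ((1 - (q - 1) * (q - 1)) * q) ^+ weight e * v0.

Lemma weight_bump e (i : nat) : (i < n)%N -> weight (bump_at e i) = (weight e).+1.
Proof.
move=> lt_i; rewrite /weight /bump_at big_split /= -addn1; congr (_ + _)%N.
by rewrite (bigD1 (Ordinal lt_i)) //= eqxx big1 // => j; rewrite -val_eqE => /negPf /= ->.
Qed.

Lemma search_loop_runs s (v0 : rat) :
    0 < q -> (q - 1) * (q - 1) <= 1 -> regs s 0%N = n -> regs s 1%N = 0%N ->
    (forall j, (j < n)%N -> cells s (6 + j)%N = 1) ->
    cells s 1%N = v0 -> cells s 2%N = 1 -> cells s 3%N = q ->
    v0 = f (grid (fun=> 0%N)) ->
    (forall e, reachable v0 e -> (weight e <= tmax)%N) ->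
    (forall e, (weight e <= tmax.+1)%N -> Good (grid e)) ->
  runs f Good search_loop s (3 + (tmax * n.+1 + n) * 73) (tmax * n.+1 + n)
    (fun s' => exists e, [/\ reachable v0 e, cells s' 1%N = f (grid e),
       cells s' 2%N = q ^+ weight e &
       forall i, (i < n)%N -> thr * f (grid e) <= f (grid (bump_at e i))]).
Proof.
move=> q0 q1 r0 r1 x1 cv c2 c3 v0E htmax hgood.
(* The variant counts the successes still possible, each worth [n.+1] so that restarting a sweep
   still decreases it, plus the coordinates left in the current sweep. *)
pose Inv k s := exists e,
  [/\ [/\ regs s 0%N = n, (regs s 1%N <= n)%N &
          ((tmax - weight e) * n.+1 + (n - regs s 1%N))%N = k],
      reachable v0 e,
      [/\ cells s 1%N = f (grid e), cells s 2%N = q ^+ weight e & cells s 3%N = q],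
      forall j, (j < n)%N -> cells s (6 + j)%N = q ^+ e j &
      forall i, (i < regs s 1%N)%N -> thr * f (grid e) <= f (grid (bump_at e i))].
have inv0 : Inv (tmax * n.+1 + n)%N s.
  have w0 : weight (fun=> 0%N) = 0%N by rewrite /weight big1.
  exists (fun=> 0%N); split; rewrite ?r1 //.
  - by split=> //; rewrite w0 !subn0.
  - by rewrite /reachable w0 expr0 mul1r v0E.
  by split; rewrite // ?cv // w0 expr0.
apply: runs_weaken (runs_while (Inv := Inv) (T := 70) (Q := 1) _ inv0) _ _ _.
- move=> k s1 [e [[i0 i1 ik] ireach [iv i2 i3] ix ifail]] /=; rewrite i0 => lt_n.
  set i := regs s1 1%N in lt_n ik ifail *.
  have we := htmax _ ireach.
  pose e' := bump_at e i.
  have we' : weight e' = (weight e).+1 by apply: weight_bump.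
  have rowE : \row_(j < n) upd (cells s1) (6 + i)%N (cells s1 (6 + i)%N * q) (6 + j)%N
      = grid e'.
    apply/rowP => j; rewrite !mxE /e' /bump_at; have [->|ji] := eqVneq (j : nat) i.
      by rewrite upd_same ix // addn1 exprSr.
    by rewrite upd_neq ?eqn_add2l // ix // addn0.
  eapply (runs_weaken (P' := fun s' => exists2 k', (k' < k)%N & Inv k' s')).
  - eapply runs_setcell_seq, runs_query_seq.
      rewrite /= i3 rowE; apply: hgood; lia.
    rewrite /= i3 rowE; eapply (runs_if (T := 20) (Q := 0)).
    rewrite /=; updsimp; rewrite i3 iv -/thr.
    case: ifP => lt_v.
    + eapply (runs_weaken (P' := fun s' => exists2 k', (k' < k)%N & Inv k' s')).
      * eapply runs_setcell_seq, runs_setcell_seq, runs_setreg.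
        rewrite /=; updsimp; rewrite i2 i3.
        have reach' : reachable v0 e'.
          rewrite /reachable we' exprS -mulrA; apply: le_trans (ltW lt_v) _.
          by rewrite ler_wpM2l // /thr mulr_ge0 ?subr_ge0 // ltW.
        have we'' := htmax _ reach'.
        exists ((tmax - weight e') * n.+1 + n)%N.
          have E : (tmax - weight e)%N = (tmax - weight e').+1 by lia.
          by rewrite -ik E mulSn; lia.
        exists e'; split=> //=.
        -- by split; rewrite ?upd_same // subn0.
        -- by split; updsimp; rewrite // we' exprSr.
        -- move=> j lt_j; updsimp; rewrite /e' /bump_at.
           have [->|ji] := eqVneq j i; first by rewrite upd_same ix // addn1 exprSr.
           by rewrite upd_neq ?eqn_add2l // ix // addn0.
      * by [].
      * by [].
      * exact.
    + eapply (runs_weaken (P' := fun s' => exists2 k', (k' < k)%N & Inv k' s')).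
      * eapply runs_setcell_seq, runs_setreg.
        rewrite /=; updsimp; rewrite i3.
        exists ((tmax - weight e) * n.+1 + (n - i.+1))%N.
          by rewrite -ik; lia.
        exists e; split=> //=.
        -- by split; rewrite ?upd_same -/i ?addn1.
        -- move=> j lt_j; have [->|ji] := eqVneq j i.
             by rewrite upd_same ix // mulfK // gt_eqF.
           by updsimp; rewrite ix.
        move=> l; rewrite upd_same addn1 ltnS leq_eqVlt => /predU1P[->|/ifail //].
        by rewrite leNgt -/e' lt_v.
      * by [].
      * by [].
      * exact.
  - by [].
  - by [].
  - by [].
- by rewrite /=; lia.
- by rewrite muln1.
move=> s' [/= nb [k [e [[i0 i1 ik] ireach [iv i2 i3] ix ifail]]]].
exists e; split=> // l lt_l; apply: ifail; move: nb; rewrite i0; lia.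
Qed.

End Program.


(** * Number of steps and bit sizes *)

Section RunningTime.

Lemma capacity_program_runs n (f : 'rV[rat]_n -> rat) (Good : 'rV[rat]_n -> Prop)
    (K tmax : nat) :
  let q : rat := 1 + 1 / (8 * n%:R * n%:R * n%:R * K.+1%:R) in
  let v0 := f (grid n q (fun=> 0%N)) in
    (forall j, (j < K)%N -> 2 ^+ j.+1 < v0) -> v0 <= 2 ^+ K.+1 ->
    (forall e, reachable f q v0 e -> (weight n e <= tmax)%N) ->
    (forall e, (weight n e <= tmax.+1)%N -> Good (grid n q e)) ->
  runs f Good capacity_program (init_state n)
    (100 * (1 + n + K + tmax * n.+1)) (1 + (tmax * n.+1 + n))
    (fun s => exists e, [/\ reachable f q v0 e,
      output s = f (grid n q e) / q ^+ weight n e &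
      forall i, (i < n)%N -> (1 - (q - 1) * (q - 1)) * q * f (grid n q e)
         <= f (grid n q (bump_at e i))]).
Proof.
move=> q v0 hK vK htmax hgood.
have row1 (s : state) : (forall j, (j < n)%N -> cells s (6 + j)%N = 1) ->
    \row_(k < n) cells s (6 + k)%N = grid n q (fun=> 0%N).
  by move=> s1; apply/rowP => j; rewrite !mxE s1 // expr0.
have d0 : 0 <= 8 * n%:R * n%:R * n%:R * K.+1%:R :> rat by rewrite !mulr_ge0.
(* For n = 0 division by zero yields q = 1. *)
have q1 : 0 <= q - 1 <= 1.
  rewrite /q addrAC subrr add0r mul1r invr_ge0 d0 -!natrM.
  set N := (_ * _)%N; case: N => [|N]; first by rewrite invr0 ler01.
  by rewrite invf_le1 ?ltr0n // ler1n.
have q0 : 0 < q by case/andP: q1 => q1 _; rewrite -(subrK 1 q) ltr_wpDl.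
have w0 : weight n (fun=> 0%N) = 0%N by rewrite /weight big1.
eapply runs_le.
- eapply runs_seq; first by apply: init_loop_runs.
  move=> s1 [a0 a5 ax].
  eapply runs_query_seq; first by rewrite /= row1 //; apply: hgood; rewrite w0.
  eapply runs_setcell_seq, runs_setcell_seq, runs_seq.
    eapply log_loop_runs with (K := K) => //=.
  + move=> j /hK; rewrite row1 //.
  + by rewrite row1.
  move=> s2 [b0 b4 bx].
  eapply runs_setcell_seq, runs_setcell_seq, runs_setreg_seq, runs_seq.
    apply: (@search_loop_runs n f Good q tmax _ v0) => //=.
  + by case/andP: q1 => q10 q11; rewrite mulr_ile1.
  + by rewrite upd_neq // b0.
  + move=> j lt_j; updsimp; rewrite bx; [|by lia..]; rewrite /=; updsimp; rewrite ax //.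
  + by updsimp; rewrite bx //=; updsimp; rewrite row1.
  + by updsimp; rewrite !(bx 5%N) //=; updsimp; rewrite a5 b4.
  move=> s3 [e [he1 he2 he3 he4]]; apply: runs_setcell; exists e; split=> //.
  by rewrite /output /= upd_same he2 he3.
- set m := (tmax * n.+1)%N; rewrite /=; lia.
- by rewrite /=; lia.
Qed.

Lemma bernoulli_le (F : realFieldType) (x : F) k : 0 <= x ->
  1 + k%:R * x <= (1 + x) ^+ k.
Proof.
move=> x0; elim: k => [|k IH]; first by rewrite mul0r addr0 expr0.
rewrite exprS; apply: le_trans (ler_wpM2l _ IH); last by lra.
have : 0 <= k%:R * x * x by rewrite !mulr_ge0.
by rewrite -natr1; nra.
Qed.

(** Bernoulli gives (1 + 1/M)^M >= 2, and the product of the two powers is (1 - 1/M^2)^M <= 1. *)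
Lemma exprBinv_le_half (F : realFieldType) M : (0 < M)%N ->
  (1 - M%:R^-1) ^+ M <= 2^-1 :> F.
Proof.
move=> M0; have M0' : 0 < M%:R :> F by rewrite ltr0n.
set x := M%:R^-1; have x0 : 0 < x by rewrite invr_gt0.
have x1 : x <= 1 by rewrite invf_le1 // ler1n.
have h1 : 2 <= (1 + x) ^+ M.
  by apply: le_trans (bernoulli_le M (ltW x0)); rewrite divff ?gt_eqF.
have h2 : (1 - x) ^+ M * (1 + x) ^+ M <= 1.
  rewrite -exprMn exprn_ile1 //; nra.
rewrite -[leRHS]mul1r ler_pdivlMr //; apply: le_trans _ h2.
by rewrite ler_wpM2l // exprn_ge0 // subr_ge0.
Qed.

(** Every N^2 successful steps at least halve the quotient of f by the product of the coordinates,
    which starts at v0 <= 2^K and stays at least 1. *)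
Lemma weight_le n (f : 'rV[rat]_n -> rat) (N K : nat) (v0 : rat) (e : nat -> nat) :
    let q : rat := 1 + N%:R^-1 in
    (0 < N)%N -> reachable f q v0 e -> q ^+ weight n e <= f (grid n q e) ->
    v0 <= 2 ^+ K ->
  (weight n e <= N ^ 2 * K)%N.
Proof.
move=> q N0 he fe vK; rewrite leqNgt; apply/negP => lt_w.
have N0' : 0 < N%:R :> rat by rewrite ltr0n.
have q0 : 0 < q by rewrite ltr_wpDr // invr_ge0 ltW.
have M0 : (0 < N ^ 2)%N by rewrite expn_gt0 N0.
have M0' : 0 < (N ^ 2)%:R :> rat by rewrite ltr0n.
have aE : 1 - (q - 1) * (q - 1) = 1 - (N ^ 2)%:R^-1.
  by rewrite /q addrAC subrr add0r natrX -expr2 exprVn.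
set a := 1 - _ in aE.
have x1 : (N ^ 2)%:R^-1 <= 1 :> rat by rewrite invf_le1 // ler1n.
have a0 : 0 <= a by rewrite aE subr_ge0.
have a1 : a < 1 by rewrite aE ltrBlDr ltrDl invr_gt0.
have : 1 <= a ^+ weight n e * 2 ^+ K.
  have qw : 0 < q ^+ weight n e by rewrite exprn_gt0.
  rewrite -(ler_pM2l qw) mulr1; apply: le_trans fe (le_trans he _).
  rewrite exprMn -/a -mulrA mulrCA ler_wpM2l ?(ltW qw) //.
  by rewrite ler_wpM2l // exprn_ge0.
apply/negP; rewrite -ltNge.
apply: (@le_lt_trans _ _ (a * (a ^+ (N ^ 2 * K) * 2 ^+ K))).
  rewrite mulrA ler_wpM2r ?exprn_ge0 // -exprS ler_wiXn2l //; exact: ltW.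
have le1 : a ^+ (N ^ 2 * K) * 2 ^+ K <= 1.
  rewrite exprM -exprMn exprn_ile1 ?mulr_ge0 ?exprn_ge0 //.
  have := exprBinv_le_half rat M0; rewrite -aE -/a; lra.
apply: le_lt_trans a1; rewrite -[leRHS]mulr1; exact: ler_wpM2l.
Qed.

(** Spending b bits per factor b instead of log b is affordable: b will be N or N + 1, itself
    polynomially bounded. *)
Lemma up_log_expn_le b k : (up_log 2 (b ^ k).+1 <= b * k + 1)%N.
Proof.
apply: up_log_min => //; rewrite expnD expn1 muln2 -addnn -addn1.
have h : (b ^ k <= 2 ^ (b * k))%N.
  by rewrite expnM; case: k => // k; rewrite leq_exp2r // ltnW // ltn_expl.
by rewrite leq_add // expn_gt0.
Qed.

Lemma rat_bits_grid N k : (0 < N)%N ->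
  (rat_bits ((1 + N%:R^-1) ^+ k) <= 3 + 2 * (N.+1 * k))%N.
Proof.
move=> N0; have N0' : N%:R != 0 :> rat by rewrite pnatr_eq0 -lt0n.
have -> : (1 + N%:R^-1) ^+ k =
    ((N.+1 ^ k)%N : int)%:~R / ((N ^ k)%N : int)%:~R :> rat.
  rewrite -!pmulrn !natrX -expr_div_n; congr (_ ^+ _).
  by rewrite -natr1 mulrDl divff // mul1r.
(* N and N + 1 are coprime, so the fraction is already reduced. *)
have cop : coprime `|((N.+1 ^ k)%N : int)| `|((N ^ k)%N : int)|.
  by rewrite !absz_nat coprimeXl // coprimeXr // coprimeSn.
rewrite /rat_bits coprimeq_num // coprimeq_den //.
have Nk : (N ^ k)%N != 0%N by rewrite expn_eq0 negb_and -lt0n N0.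
rewrite eqz_nat (negPf Nk) gtr0_sg ?ltz_nat ?lt0n // mul1r absz_id !absz_nat.
have := up_log_expn_le N.+1 k; have := up_log_expn_le N k.
have := leq_mul (leqnSn N) (leqnn k); lia.
Qed.

Lemma vec_bits_grid n N e t : (0 < N)%N -> (weight n e <= t)%N ->
  (vec_bits (grid n (1 + N%:R^-1) e) <= n * (3 + 2 * (N.+1 * t)))%N.
Proof.
move=> N0 we; rewrite /vec_bits -[X in (_ <= X * _)%N]card_ord -sum_nat_const.
apply: leq_sum => i _; rewrite mxE; apply: leq_trans (rat_bits_grid _ N0) _.
rewrite leq_add2l leq_mul2l leq_mul2l; apply/orP; right; apply/orP; right.
by apply: leq_trans we; rewrite /weight (bigD1 i) //= leq_addr.
Qed.

End RunningTime.

(** * Transfer to the reals and the effect of a failed step *)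

Lemma ratr_eval_oracle (R : realType) n (p : {mpoly int[n]}) (x : 'rV[rat]_n) :
  ratr (eval_oracle p x) = (map_mpoly intr p : {mpoly R[n]}).@[fun i => ratr (x 0 i)].
Proof.
rewrite /eval_oracle !meval_map_mpoly rmorph_mmap.
by apply: mmap_eq => [z|i] //=; rewrite ratr_int.
Qed.

Lemma ratr_mixed_derivative (R : realType) n (p : {mpoly int[n]}) :
  ratr (mixed_derivative (map_mpoly intr p : {mpoly rat[n]})) =
  mixed_derivative (map_mpoly intr p) :> R.
Proof. by rewrite !mixed_derivativeE !mcoeff_map_mpoly ratr_int. Qed.

(** From exp (-1/2) >= 1 - 1/2; it serves to bound the exponent K by 2 log p(1, ..., 1). *)
Lemma ln2_ge_half (R : realType) : 2^-1 <= ln 2 :> R.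
Proof.
have h := expR_ge1Dx (- 2^-1 : R).
have e0 := expR_gt0 (2^-1 : R).
rewrite expRN in h; rewrite -ler_expR lnK ?posrE //.
rewrite -[leLHS]invrK -[leRHS]invrK lef_pV2 ?posrE ?invr_gt0 //.
by apply: le_trans h; lra.
Qed.

(** Failure gives (1 - s^2) (1 + s) <= 1 + s moment + n^2 s^2; it remains to divide by s and use s
    <= 1. *)
Lemma moment_of_failed_step (R : realType) n (p : {mpoly R[n]}) x i (s : R) :
    hom_plus n p -> p != 0 -> (forall j, 0 < x j) -> 0 < s -> n%:R * s <= 1 ->
    (1 - s * s) * (1 + s) * p.@[x] <= p.@[setv x i (x i * (1 + s))] ->
  1 - (n%:R ^+ 2 + 2) * s <= moment p x i.
Proof.
move=> [hp p0] pn0 x0 s0 ns h.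
have px0 : 0 < p.@[x] by apply: meval_gt0.
have n1 : 1 <= n%:R :> R by rewrite ler1n; case: (i) => m; apply: leq_ltn_trans.
have := le_trans h (moment_ge i hp p0 (fun j => ltW (x0 j)) px0 (ltW s0) ns).
rewrite mulrC ler_pM2l // => h2.
have h3 : s * (1 - (n%:R ^+ 2 + 2) * s) <= s * moment p x i.
  have s1 : s <= 1 by nra.
  have : 0 <= s * s * (1 - s) by rewrite !mulr_ge0 ?subr_ge0 // ltW.
  by move: h2; rewrite !expr2; lra.
by rewrite ler_pM2l in h3.
Qed.

(** * Explicit polynomials bounding queries, bit sizes and operations *)

Section ResourceBounds.
Context (R : realType).

(* ['X] stands for n and the inner variable for log p(1, ..., 1). *)
Definition log_poly : {poly {poly R}} := (1 + 2 *: 'X)%:P.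
Definition grid_poly : {poly {poly R}} := 8 * 'X ^+ 3 * log_poly.
Definition step_poly : {poly {poly R}} := grid_poly ^+ 2 * log_poly.
Definition query_poly : {poly {poly R}} := 1 + (step_poly * ('X + 1) + 'X).
Definition bits_poly : {poly {poly R}} :=
  'X * (3 + 2 * ((grid_poly + 1) * (step_poly + 1))).
Definition time_poly : {poly {poly R}} :=
  100 * (1 + 'X + log_poly + step_poly * ('X + 1)).

Lemma eval2E (a b : R) :
  (forall P Q : {poly {poly R}}, (P + Q).[a, b] = P.[a, b] + Q.[a, b]) *
  (forall P Q : {poly {poly R}}, (P * Q).[a, b] = P.[a, b] * Q.[a, b]) *
  (forall (P : {poly {poly R}}) k, (P ^+ k).[a, b] = P.[a, b] ^+ k) *
  (forall k, (k%:R : {poly {poly R}}).[a, b] = k%:R) *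
  (('X : {poly {poly R}}).[a, b] = a) * ((1 : {poly {poly R}}).[a, b] = 1) *
  (log_poly.[a, b] = 1 + 2 * b).
Proof.
have H : forall k, (k%:R : {poly {poly R}}).[a, b] = k%:R.
  by move=> k; rewrite -polyC_natr hornerC -polyC_natr hornerC.
do ![split] => [P Q|P Q|P k|//|||].
- by rewrite !hornerD.
- by rewrite !hornerM.
- by rewrite !horner_exp.
- by rewrite hornerX hornerC.
- exact: (H 1%N).
- by rewrite /log_poly hornerC !hornerE.
Qed.

Lemma poly_bounds (n K : nat) (y : R) : K%:R <= 1 + 2 * y ->
  let N := (8 * n ^ 3 * K)%N in let t := (N ^ 2 * K)%N in
  [/\ (1 + (t * n.+1 + n))%:R <= query_poly.[n%:R, y],
      (n * (3 + 2 * (N.+1 * t.+1)))%:R <= bits_poly.[n%:R, y] &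
      (100 * (1 + n + K + t * n.+1))%:R <= time_poly.[n%:R, y]].
Proof.
move=> Ky N t; set g := grid_poly.[n%:R, y]; set h := step_poly.[n%:R, y].
have -> : query_poly.[n%:R, y] = 1 + (h * (n%:R + 1) + n%:R) by rewrite /h !eval2E.
have -> : bits_poly.[n%:R, y] = n%:R * (3 + 2 * ((g + 1) * (h + 1))).
  by rewrite /g /h !eval2E.
have -> : time_poly.[n%:R, y] = 100 * (1 + n%:R + (1 + 2 * y) + h * (n%:R + 1)).
  by rewrite /h !eval2E.
have K0 : 0 <= K%:R :> R by [].
have y0 : 0 <= 1 + 2 * y := le_trans K0 Ky.
have n0 : 0 <= n%:R :> R by [].
have NE : N%:R <= g.
  by rewrite /g !eval2E /N !natrM ler_wpM2l ?mulr_ge0 ?exprn_ge0.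
have N0 : 0 <= g := le_trans (ler0n _ _) NE.
have tE : t%:R <= h.
  have -> : h = g ^+ 2 * (1 + 2 * y) by rewrite /h /g !eval2E.
  by rewrite /t natrM natrX ler_pM ?exprn_ge0 // lerXn2r ?nnegrE.
have t0 : 0 <= h := le_trans (ler0n _ _) tE.
have tn : (t * n.+1)%:R <= h * (n%:R + 1).
  by rewrite natrM -natr1 ler_wpM2r ?addr_ge0.
split.
- by rewrite !natrD lerD2l lerD2r.
- rewrite natrM ler_wpM2l // natrD natrM lerD2l ler_wpM2l // natrM -!natr1.
  by rewrite ler_pM ?addr_ge0 // lerD2r.
- by rewrite natrM ler_wpM2l // !natrD lerD // lerD2l.
Qed.

End ResourceBounds.

Theorem theorem4p7 (R : realType) :
  exists (A : cmd) (Q B T : {poly {poly R}}),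
    forall (n : nat) (p : {mpoly int[n]}),
      let pR : {mpoly R[n]} := map_mpoly intr p in
      let D : rat := mixed_derivative (map_mpoly intr p) in
      let G : rat := \prod_(i < n) gfun (minn (max_degree p i) (n - i)) in
      hom_plus n pR -> pos_hyperbolic pR -> indecomposable pR ->
      exists F : rat,
        [/\ computes A Q B T p F,
            D <= F,
            F <= 2 * G^-1 * D
          & 2 * G^-1 * D <= 2 * (n%:R ^+ n / n`!%:R) * D].
Proof.
exists capacity_program, (query_poly R), (bits_poly R), (time_poly R).
move=> n p pR D G hp hyp ip; have [hom p0] := hp.
have sp : stable pR := stable_pos_hyperbolic hp hyp.
have pe : 0 < pR.@[fun=> 1] by case: hyp.
have pn0 : pR != 0 by apply: contraTneq pe => ->; rewrite meval0 ltxx.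
have bd : degree_bound pR (max_degree p).
  move=> m i mp; apply: (@leq_bigmax_seq _ _ _ (fun m : 'X_{1..n} => m i)) => //.
  by rewrite -(perm_mem (msupp_map_mpoly p (@intr_inj R))).
have GE : ratr G = \prod_(i < n) greal R (minn (max_degree p i) (n - i)).
  by rewrite rmorph_prod; apply: eq_bigr => i _; rewrite /= ratr_gfun.
have GR0 : 0 < ratr G :> R by rewrite GE prodr_gt0 // => i _; apply: greal_gt0.
have G0 : 0 < G by rewrite -(ltr0q R).
have DE : ratr D = mixed_derivative pR := ratr_mixed_derivative R p.
have capD : ratr G * capacity pR <= ratr D.
  by rewrite GE DE; apply: capacity_le_mixed_derivative.
have D0 : 0 < ratr D :> R by apply: lt_le_trans capD; rewrite mulr_gt0 ?capacity_gt0.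
have D1 : 1 <= ratr D :> R.
  move: D0; rewrite DE mixed_derivativeE mcoeff_map_mpoly => D0.
  by apply: intr_ge1; rewrite ?ltW ?gt_eqF.
clearbody D G; pose f := eval_oracle p.
have fE q e : ratr (f (grid n q e)) = pR.@[fun i : 'I_n => ratr q ^+ e i] :> R.
  by rewrite ratr_eval_oracle; apply: meval_eq => i; rewrite mxE rmorphXn.
pose v0 := f (grid n 0 (fun=> 0%N)).
have v0E q : f (grid n q (fun=> 0%N)) = v0.
  by congr f; apply/rowP => i; rewrite !mxE !expr0.
have v0R : ratr v0 = pR.@[fun=> 1] by rewrite fE; apply: meval_eq => i; rewrite expr0.
have v00 : 0 <= v0 by rewrite -(ler0q R) v0R ltW.
have exK : exists K, v0 <= 2 ^+ K.+1.
  exists (Num.bound v0); apply: le_trans (ltW (archi_boundP v00)) _.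
  by rewrite -natrX ler_nat ltnW // ltnW // ltn_expl.
(* The least K matches the exponent at which [log_loop] stops, and minimality gives 2^K < p(1, ...,
   1) when K > 0. *)
case: (ex_minnP exK) => K vK minK.
have hK j : (j < K)%N -> 2 ^+ j.+1 < v0.
  by move=> jK; rewrite ltNge; apply/negP => /minK; rewrite leqNgt jK.
pose N := (8 * n ^ 3 * K.+1)%N; pose t := (N ^ 2 * K.+1)%N.
pose q : rat := 1 + 1 / (8 * n%:R * n%:R * n%:R * K.+1%:R).
have qE : q = 1 + N%:R^-1.
  by rewrite /q /N !natrM mul1r; congr (1 + _^-1); ring.
have N0 : (0 < n)%N -> (0 < N)%N by move=> n0; rewrite !muln_gt0 n0.
have q0 : 0 < q by rewrite qE ltr_wpDr // invr_ge0.
have qR0 : 0 < ratr q :> R by rewrite ltr0q.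
have prodE (e : nat -> nat) : \prod_(i < n) ratr q ^+ e i = ratr (q ^+ weight n e) :> R.
  by rewrite rmorphXn prodrXr.
(* The mixed derivative is the coefficient of a single term of p. This gives D <= F and, as D >= 1,
   the limit on the number of steps. *)
have lower e : D * q ^+ weight n e <= f (grid n q e).
  rewrite -(ler_rat R) rmorphM /= fE -prodE DE.
  by apply: le_mixed_derivative => // i; rewrite exprn_ge0 // ltW.
have D1q : 1 <= D by rewrite -(ler_rat R) rmorph1.
have htmax e : reachable f q v0 e -> (weight n e <= t)%N.
  case: (posnP n) => [n0 _|n0].
    by rewrite /weight big1 // => -[i li]; exfalso; move: (li); rewrite n0.
  rewrite qE => he; apply: (weight_le (N0 n0) he) vK; rewrite -qE.
  by apply: le_trans (lower e); rewrite ler_peMl ?exprn_ge0 ?(ltW q0).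
pose Good (x : 'rV[rat]_n) := (vec_bits x <= n * (3 + 2 * (N.+1 * t.+1)))%N.
have hgood e : (weight n e <= t.+1)%N -> Good (grid n q e).
  case: (posnP n) => [n0 _|n0].
    by rewrite /Good /vec_bits big1 // => -[i li]; exfalso; move: (li); rewrite n0.
  by move=> we; rewrite /Good qE; apply: vec_bits_grid we; apply: N0.
have := @capacity_program_runs n f Good K t; rewrite /= -/q v0E.
move=> /(_ hK vK htmax hgood) [tm [qs [s [hexec htm hqs hgq [e [he out stop]]]]]].
have w0 : 0 < q ^+ weight n e by rewrite exprn_gt0.
exists (output s); split.
(* K log 2 <= log p(1, ..., 1) with log 2 >= 1/2; for K = 0 the logarithm is nonnegative because
   p(1, ..., 1) >= D >= 1. *)
- have y0 : K.+1%:R <= 1 + 2 * ln pR.@[fun=> 1].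
    rewrite -natr1 addrC lerD2l.
    case: (posnP K) => [->|Kp].
      rewrite mulr_ge0 // ln_ge0 // -v0R -(rmorph1 (@ratr R)) ler_rat.
      by have := lower (fun=> 0%N); rewrite v0E /weight big1 // expr0 mulr1; apply: le_trans.
    have : 2 ^+ K <= pR.@[fun=> 1].
      rewrite -v0R -(rmorph_nat (@ratr R) 2) -rmorphXn ler_rat ltW //.
      by have := hK K.-1; rewrite prednK // => /(_ (leqnn _)).
    rewrite -ler_ln ?posrE ?exprn_gt0 // lnXn // -[ln 2 *+ K]mulr_natl => lnK.
    have := ler_wpM2l (ler0n R K) (ln2_ge_half R); lra.
  have [bq bb bt] := poly_bounds n y0.
  exists tm, qs, s; split=> //; split.
  + by apply: le_trans bq; rewrite ler_nat.
  + by move=> x /hgq gx; apply: le_trans bb; rewrite ler_nat.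
  + apply: le_trans bt; rewrite ler_nat (leq_trans htm) // leq_mul2l /=.
    by rewrite leq_add2r leq_add2l leqnSn.
- by rewrite out ler_pdivlMr.
- rewrite out ler_pdivrMr // -(ler_rat R) fE !rmorphM /= fmorphV /=.
  rewrite (rmorph_nat (@ratr R) 2).
  pose x (i : 'I_n) : R := ratr q ^+ e i.
  have x0 i : 0 < x i by rewrite exprn_gt0.
  pose d : R := N%:R^-1.
  have d0 : 0 <= d by rewrite invr_ge0.
  have qd : ratr q = 1 + d by rewrite qE rmorphD rmorph1 fmorphV /= ratr_nat.
  have N1 : (0 < n)%N -> 0 < N%:R :> R by move=> n0; rewrite ltr0n N0.
  have qq : 0 <= 1 - (q - 1) * (q - 1) <= 1.
    rewrite qE addrAC subrr add0r.
    have : 0 <= (N%:R^-1 : rat) <= 1.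
      rewrite invr_ge0 ler0n /=; case: (N) => [|m]; first by rewrite invr0.
      by rewrite invf_le1 ?ltr0n // ler1n.
    by case/andP=> a0 a1; rewrite subr_ge0 gerBl mulr_ge0 // mulr_ile1.
  have main : pR.@[x] <= 2 * capacity pR * \prod_i x i.
    apply: (@meval_le_2capacity R n p x K.+1 ((n%:R ^+ 2 + 2) * d)) => //.
    - by rewrite -/pR -v0R -(rmorph_nat (@ratr R) 2) -rmorphXn ler_rat.
    - rewrite -/pR -fE prodE -v0R -rmorphM ler_rat; apply: le_trans he _.
      rewrite [leRHS]mulrC ler_wpM2r // exprMn ler_piMl ?(ltW w0) //.
      by case/andP: qq => qq0 qq1; apply: exprn_ile1.
    - move=> i; have n0 : (0 < n)%N by case: (i) => m; apply: leq_ltn_trans.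
      apply: moment_of_failed_step => //.
      + by rewrite invr_gt0 N1.
      + rewrite ler_pdivrMr ?N1 // mul1r ler_nat /N.
        by rewrite expnS mulnCA -mulnA leq_pmulr // !muln_gt0 n0.
      have := stop i (ltn_ord i); rewrite -(ler_rat R) rmorphM !fE.
      rewrite rmorphM rmorphB rmorph1 rmorphM rmorphB rmorph1 /= fE -/x qd addrAC subrr add0r.
      move=> h; apply: le_trans h _; rewrite le_eqVlt; apply/orP; left; apply/eqP.
      rewrite -qd; apply: meval_eq => j; rewrite /x /setv /bump_at -val_eqE /=.
      by case: eqP => [->|_]; rewrite ?addn1 ?addn0 // exprSr.
    - by rewrite mulr_ge0 // addr_ge0 // exprn_ge0.
    (* The 8 in the grid ratio is used here: 2 n (n^2 + 2) <= 8 n^3 for n >= 1. *)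
    case: (posnP n) => [n0|n0]; first by rewrite {1}n0 mulr0 !mul0r.
    rewrite mulrA ler_pdivrMr ?N1 // mul1r /N !natrM.
    have n1 : 1 <= n%:R :> R by rewrite ler1n.
    have k0 : 0 <= K.+1%:R :> R by [].
    have nk : 0 <= n%:R * K.+1%:R :> R by rewrite mulr_ge0.
    have : 0 <= (n%:R * K.+1%:R) * (6 * (n%:R ^+ 2 - 1)) :> R.
      by rewrite !mulr_ge0 // subr_ge0 exprn_ege1.
    by have := nk; rewrite !expr2; lra.
  have capG : capacity pR <= (ratr G)^-1 * ratr D by rewrite ler_pdivlMl.
  apply: le_trans main _; rewrite prodE ler_wpM2r ?ler0q ?(ltW w0) //.
  by rewrite -[leRHS]mulrA ler_pM2l.
(* As g decreases, G is at least the product of the g(n - i), which is n! / n^n. *)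
rewrite ler_pM2r; last by rewrite -(ltr0q R).
rewrite ler_pM2l // -(ler_rat R) fmorphV rmorphM fmorphV /= rmorphXn /= !ratr_nat.
rewrite -invf_div -prod_greal_rev lef_pV2 ?posrE // ?GE.
  apply: ler_prod => i _; rewrite greal_ge0 /=; apply: greal_anti; exact: geq_minr.
by rewrite prodr_gt0 // => i _; apply: greal_gt0.
Qed.
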